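(* Let $P(\lambda)=\sum_{i=0}^m \lambda^i A_i$ with $A_i\in\mathbb{C}^{n\times n}$ be an $n\times n$ matrix polynomial of normal rank $r<n$, let $\lambda_0\in\mathbb{C}$ be a simple (finite) eigenvalue of $P$, let $\gamma_P$ be the associated quantity defined in the context, and set $N=n^2(m+1)$. Then for every $\delta>0$ with $$\delta\le \frac{(N-1)(n-r)}{(N+n-r-2)(N+n-r-1)},$$ the $\delta$-weak condition number $\kappa_w^{(P)}(\delta)$ of $\lambda_0$ satisfies $$\kappa_w^{(P)}(\delta)\ \ge\ \sqrt{\frac{(N-1)(n-r)}{(N+n-r-2)(N+n-r-1)\,\delta}}\;\frac{1}{\gamma_P}\ \ge\ \frac{1}{\sqrt{N\delta}}\,\frac{1}{\gamma_P}.$$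
   Context: Let $P(\lambda)=\sum_{i=0}^m\lambda^iA_i$, $A_i\in\mathbb{C}^{n\times n}$. Its normal rank is $r=\max_{\lambda\in\mathbb{C}}\operatorname{rank}P(\lambda)$. A number $\lambda_0\in\mathbb{C}$ is a (finite) eigenvalue if $\operatorname{rank}P(\lambda_0)<r$; it is simple if, in the Smith canonical form of $P$, exactly one of the nonzero invariant polynomials vanishes at $\lambda_0$, and it has a simple zero there. Then $\dim\ker P(\lambda_0)=n-r+1$. Singular spaces. Let $\mathcal{N}(P)=\{x(\lambda)\in\mathbb{C}(\lambda)^n: P(\lambda)x(\lambda)\equiv0\}$ and $\mathcal{N}_*(P)=\{y(\lambda)\in\mathbb{C}(\overline\lambda)^n: y(\lambda)^*P(\lambda)\equiv0\}$; both have dimension $n-r$. A minimal basis is a polynomial basis whose sum of column degrees is minimal among all polynomial bases. If $[x_1(\lambda),\dots,x_{n-r}(\lambda)]$ and $[y_1(\lambda),\dots,y_{n-r}(\lambda)]$ are minimal bases of $\mathcal{N}(P)$ and $\mathcal{N}_*(P)$, set $\ker_{\lambda_0}(P)=\operatorname{range}[x_1(\lambda_0),\dots,x_{n-r}(\lambda_0)]\subsetneq\ker P(\lambda_0)$ and $\ker_{\lambda_0}(P^* )=\operatorname{range}[y_1(\lambda_0),\dots,y_{n-r}(\lambda_0)]\subsetneq\ker (P(\lambda_0)^* )$. Bases. Choose $[X\ x]$ and $[Y\ y]$ in $\mathbb{C}^{n\times(n-r+1)}$ with orthonormal columns, being bases of $\ker P(\lambda_0)$ and $\ker(P(\lambda_0)^*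 )$ respectively, such that the columns of $X\in\mathbb{C}^{n\times(n-r)}$ form a basis of $\ker_{\lambda_0}(P)$ and those of $Y\in\mathbb{C}^{n\times(n-r)}$ a basis of $\ker_{\lambda_0}(P^* )$. Define $$\gamma_P=\frac{|y^*P'(\lambda_0)x|}{\big(\sum_{j=0}^m|\lambda_0|^{2j}\big)^{1/2}}.$$ Weak condition number. For a perturbation $E(\lambda)=\sum_{i=0}^m\lambda^iE_i$, $E_i\in\mathbb{C}^{n\times n}$, let $\|E\|=(\sum_{i=0}^m\|E_i\|_F^2)^{1/2}$ and define the directional sensitivity (whenever $Y^*E(\lambda_0)X$ is nonsingular, which holds almost surely below) $$\sigma_E=\frac{1}{\|E\|}\left|\frac{\det\big([Y\ y]^*E(\lambda_0)[X\ x]\big)}{y^*P'(\lambda_0)x\cdot\det\big(Y^*E(\lambda_0)X\big)}\right|.$$ Let $N=n^2(m+1)$, and write $E\sim\mathcal{U}(2N)$ if the vectorization of $[E_0\ E_1\ \cdots\ E_m]$ is uniformly distributed on the unit sphere of $\mathbb{C}^{N}$. The $\delta$-weak condition number of $\lambda_0$ is $$\kappa_w^{(P)}(\delta)=\inf\{t\in\mathbb{R}:\ \mathbb{P}(\sigma_E<t)\ge1-\delta\},\qquad E\sim\mathcal{U}(2N).$$ *)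

(* Defs.v *)
From HB Require Import structures.
From mathcomp Require Import all_boot all_order all_algebra.
From mathcomp Require Import complex.
From mathcomp Require Import all_classical all_reals all_analysis.

Set Implicit Arguments.
Unset Strict Implicit.
Unset Printing Implicit Defensive.

Import Order.TTheory GRing.Theory Num.Theory.
Import numFieldNormedType.Exports.

Local Open Scope classical_set_scope.
Local Open Scope ring_scope.

Section LinearAlgebra.
Context {F : fieldType}.

Definition nullspace n (M : 'M[F]_n) : set 'cV[F]_n := [set v | M *m v = 0].

Definition colspace n k (M : 'M[F]_(n, k)) : set 'cV[F]_n :=
  range (fun c : 'cV[F]_k => M *m c).

Definition col_basis n k (M : 'M[F]_(n, k)) (S : set 'cV[F]_n) : Prop :=
  row_free M^T /\ colspace M = S.

End LinearAlgebra.

Section PolynomialMatrices.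
Context {F : fieldType}.

(* U and V are unimodular: units of the matrix ring over F[X]. The zero
   diagonal entries, if any, come last, since 0 divides only 0. *)
Definition smith_form n (M : 'M[{poly F}]_n) (d : 'rV[{poly F}]_n) : Prop :=
  [/\ exists U V : 'M[{poly F}]_n,
        [/\ U \in unitmx, V \in unitmx & U *m M *m V = diag_mx d],
      forall i, d 0 i != 0 -> d 0 i \is monic
    & forall i j : 'I_n, (i <= j)%N -> dvdp (d 0 i) (d 0 j)].

Definition poly_basis n k (S : set 'cV[{fraction {poly F}}]_n)
    (B : 'M[{poly F}]_(n, k)) : Prop :=
  col_basis (map_mx (@FracField.tofrac _) B) S.

Definition col_degree n k (B : 'M[{poly F}]_(n, k)) (j : 'I_k) : nat :=
  \max_(i < n) (size (B i j)).-1.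

Definition minimal_basis n k (S : set 'cV[{fraction {poly F}}]_n)
    (B : 'M[{poly F}]_(n, k)) : Prop :=
  poly_basis S B /\
  forall B' : 'M[{poly F}]_(n, k), poly_basis S B' ->
    (\sum_(j < k) col_degree B j <= \sum_(j < k) col_degree B' j)%N.

(* The matrix polynomial sum_i z^i A_i: its value and the value of its
   derivative at a point, and the same polynomial as a matrix over F[X]. *)
Definition mpeval n m (A : 'I_m.+1 -> 'M[F]_n) (z : F) : 'M[F]_n :=
  \sum_(i < m.+1) z ^+ i *: A i.

Definition mpderiv n m (A : 'I_m.+1 -> 'M[F]_n) (z : F) : 'M[F]_n :=
  \sum_(i < m.+1) (z ^+ i.-1 *+ i) *: A i.

Definition mppoly n m (A : 'I_m.+1 -> 'M[F]_n) : 'M[{poly F}]_n :=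
  \sum_(i < m.+1) 'X^i *: map_mx polyC (A i).

Definition normal_rank n m (A : 'I_m.+1 -> 'M[F]_n) (r : nat) : Prop :=
  (exists z, \rank (mpeval A z) = r) /\
  (forall z, (\rank (mpeval A z) <= r)%N).

Definition eigenvalue_mp n m (A : 'I_m.+1 -> 'M[F]_n) (z0 : F) : Prop :=
  exists2 r, normal_rank A r & (\rank (mpeval A z0) < r)%N.

Definition simple_eigenvalue_mp n m (A : 'I_m.+1 -> 'M[F]_n) (z0 : F) : Prop :=
  eigenvalue_mp A z0 /\
  exists d, smith_form (mppoly A) d /\
    exists i, [/\ d 0 i != 0, root (d 0 i) z0, mup z0 (d 0 i) = 1%N
                & forall j, d 0 j != 0 -> root (d 0 j) z0 -> j = i].

Definition singular_space n m (A : 'I_m.+1 -> 'M[F]_n) :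
    set 'cV[{fraction {poly F}}]_n :=
  nullspace (map_mx (@FracField.tofrac _) (mppoly A)).

Definition eval_mx n k (B : 'M[{poly F}]_(n, k)) (z : F) : 'M[F]_(n, k) :=
  map_mx (fun p : {poly F} => p.[z]) B.

End PolynomialMatrices.

Section Complex.
Context {R : realType}.
Local Notation C := R[i].

Definition ctmx p q (M : 'M[C]_(p, q)) : 'M[C]_(q, p) :=
  (map_mx (@conjc R) M)^T.

(* The coefficients of P^*.  An element y of N_*(P) is a vector of rational
   functions of the conjugate variable w = conj z, and y^* P = 0 means
   P^* y = sum_i w^i A_i^* y = 0. Written in the variable w, the space N_*(P)
   is thus singular_space (adjoint_mp A), the degrees being degrees in w;
   the value of y at the point z is obtained by setting w = conj z. *)
Definition adjoint_mp n m (A : 'I_m.+1 -> 'M[C]_n) : 'I_m.+1 -> 'M[C]_n :=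
  fun i => ctmx (A i).

Definition left_singular_space n m (A : 'I_m.+1 -> 'M[C]_n) :
    set 'cV[{fraction {poly C}}]_n :=
  singular_space (adjoint_mp A).

Definition orthonormal_cols p q (M : 'M[C]_(p, q)) : Prop :=
  ctmx M *m M = 1%:M.

Definition normc (z : C) : R := ComplexField.Normc.normc z.

Definition frobenius p q (M : 'M[C]_(p, q)) : R :=
  Num.sqrt (\sum_(i < p) \sum_(j < q) normc (M i j) ^+ 2).

Definition mpnorm n m (E : 'I_m.+1 -> 'M[C]_n) : R :=
  Num.sqrt (\sum_(i < m.+1) frobenius (E i) ^+ 2).

Definition sesq n (y : 'cV[C]_n) (M : 'M[C]_n) (x : 'cV[C]_n) : C :=
  (ctmx y *m M *m x) 0 0.

Definition gammaP n m (A : 'I_m.+1 -> 'M[C]_n) (z0 : C) (x y : 'cV[C]_n) : R :=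
  normc (sesq y (mpderiv A z0) x) /
  Num.sqrt (\sum_(j < m.+1) normc z0 ^+ (2 * j)).

(* When Y^* E(z0) X is singular the quotient by 0 makes this 0. *)
Definition sensitivity n m k (A : 'I_m.+1 -> 'M[C]_n) (z0 : C)
    (X Y : 'M[C]_(n, k)) (x y : 'cV[C]_n) (E : 'I_m.+1 -> 'M[C]_n) : R :=
  (mpnorm E)^-1 *
  normc (\det (ctmx (row_mx Y y) *m mpeval E z0 *m row_mx X x) /
         (sesq y (mpderiv A z0) x * \det (ctmx Y *m mpeval E z0 *m X))).

End Complex.

Section UniformOnSphere.
Context {R : realType}.

(* Lebesgue measure on R^k, by iterated integration of sections. *)
Fixpoint lebesgue_tuple (k : nat) : set (k.-tuple R) -> \bar R :=
  match k with
  | 0 => fun A => \d_([tuple] : 0.-tuple R) A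
  | k'.+1 => fun A =>
      (\int[@lebesgue_measure R]_u
        lebesgue_tuple [set t : k'.-tuple R | A (cons_tuple u t)])%E
  end.

Definition tnorm k (t : k.-tuple R) : R :=
  Num.sqrt (\sum_(i < k) tnth t i ^+ 2).

Definition tscale k (a : R) (t : k.-tuple R) : k.-tuple R :=
  [tuple a * tnth t i | i < k].

(* The points of the unit ball, 0 excepted, that project radially into A. *)
Definition cone k (A : set (k.-tuple R)) : set (k.-tuple R) :=
  [set t | 0 < tnorm t <= 1 /\ A (tscale (tnorm t)^-1 t)].

(* Normalised surface measure of (the trace of A on) the unit sphere of R^k. *)
Definition sphere_measure k (A : set (k.-tuple R)) : R :=
  fine (lebesgue_tuple (cone A)) /
  fine (lebesgue_tuple [set t : k.-tuple R | tnorm t <= 1]).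

Definition uniform_on_sphere d (T : measurableType d) (Pr : probability T R)
    k (Z : T -> k.-tuple R) : Prop :=
  measurable_fun [set: T] Z /\
  forall A : set (k.-tuple R), measurable A ->
    Pr (Z @^-1` A) = (sphere_measure A)%:E.

(* vec [E_0 ... E_m] in C^N = R^(2N), N = n^2 (m + 1): the real and the
   imaginary parts of all the entries. *)
Definition realvec n m (E : 'I_m.+1 -> 'M[R[i]]_n) :
    #|{: 'I_m.+1 * 'I_n * 'I_n * bool}|.-tuple R :=
  codom_tuple (fun p : 'I_m.+1 * 'I_n * 'I_n * bool =>
    let: (i, a, b, im) := p in
    if im then complex.Im (E i a b) else complex.Re (E i a b)).

Definition uniform_perturbation d (T : measurableType d)
    (Pr : probability T R) n m (E : T -> 'I_m.+1 -> 'M[R[i]]_n) : Prop :=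
  uniform_on_sphere Pr (fun w => realvec (E w)).

Definition weak_cond d (T : measurableType d) (Pr : probability T R)
    (sigma : T -> R) (delta : R) : R :=
  inf [set t : R | ((1 - delta)%:E <= Pr [set w | (sigma w < t)%R])%E].

End UniformOnSphere.

(* Main.v *)
(* Put k = n - r and s = gamma_P t.  In suitable orthonormal coordinates
   E = (e, F, g), where [F g] is the matrix [Y y]^* E(lambda0) [X x] up to a
   scalar, the event sigma_E >= t reads
   |det [F g]|^2 >= s^2 |E|^2 |det [F e_last]|^2.
   Introduce an auxiliary point u uniform in the unit ball of C^(k+1).  Rotating
   the rows of [F g] by a unitary matrix taking e_last to u / |u| shows that
   e_last may be replaced by u / |u| without changing probabilities.  For fixed
   (e, F, g) the remaining condition on u is |<v, u>|^2 <= tau |u|^2 with v the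
   unit vector of cofactors of F, which has probability 1 - (1 - tau)^k, and for
   tau = zeta / s^2 with zeta = |<v, g>|^2 / |E|^2 whose law is again a Beta law,
   P(zeta <= tau) = 1 - (1 - tau)^(N - 1).  Concavity and the moments of 1 - zeta
   give P(sigma_E >= t) >= k / (s^2 (N + k - 1)) for s >= 1, and strictly more
   than k / (N + k - 1) for s < 1.
   All invariances come from one fact: an additive bijective isometry between
   two spaces with translation invariant measures rescales the volume. *)

Require Import Defs.
From HB Require Import structures.
From mathcomp Require Import all_boot all_order all_algebra.
From mathcomp Require Import complex.
From mathcomp Require Import all_classical all_reals all_analysis.
From mathcomp Require Import spectral measurable_realfun lebesgue_integral zify ring lra.

Set Implicit Arguments.
Unset Strict Implicit.
Unset Printing Implicit Defensive.

Import Order.TTheory GRing.Theory Num.Theory.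
Import numFieldNormedType.Exports.

Local Open Scope classical_set_scope.
Local Open Scope ring_scope.

(** * Euclidean spaces with a translation invariant volume *)

(** The obstacle is that both determinants pair the same random vector: with v the cofactor vector
    of F they are <v, g> and the last entry of v, so that their ratio depends on the direction of v,
    whose law would have to be found. Against an independent u the computation is made for v fixed,
    and its direction no longer matters. Almost no volume is computed. The sensitivity is invariant
    under dilations, so the sphere is traded for the ball, and every probability is a proportion of
    a unit ball; the constants relating volumes of different spaces cancel. Strictness for s < 1 has
    a reason. The condition number is an infimum over the t with P(sigma_E < t) >= 1 - delta, so
    excluding a t takes P(sigma_E >= t) > delta. The constant of the statement is k / (N + k - 1)
    times (N - 1) / (N + k - 2), a factor which is 1 when k = 1. For k = 1 and the largest
    admissible delta the bound at s = 1 thus leaves no room. *)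

(** [enrm] is the squared norm and [edim] the real dimension. Operations and volume are bundled on a
    bare measurable type, so that products, tuples and transported types all fit. [eaddNK] is the
    cancellation -(x + y) + y = -x, the form in which subtraction enters the isometry argument. *)
Record euclid (R : realType) d (T : measurableType d) := Euclid {
  eadd : T -> T -> T;
  eopp : T -> T;
  escal : R -> T -> T;
  enrm : T -> R;
  edim : nat;
  evol : {sigma_finite_measure set T -> \bar R};
  eadd_meas : measurable_fun [set: T * T] (fun p => eadd p.1 p.2);
  eopp_meas : measurable_fun [set: T] eopp;
  escal_meas : forall a, measurable_fun [set: T] (escal a);
  enrm_meas : measurable_fun [set: T] enrm;
  eaddC : forall x y, eadd x y = eadd y x;
  eaddNK : forall x y, eadd (eopp (eadd x y)) y = eopp x;
  enrm_opp : forall x, enrm (eopp x) = enrm x;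
  enrm_scal : forall a x, enrm (escal a x) = a ^+ 2 * enrm x;
  enrm_ge0 : forall x, 0 <= enrm x;
  evol_add : forall v S, measurable S -> evol [set x | S (eadd v x)] = evol S;
  evol_scal : forall a S, 0 < a -> measurable S ->
    evol [set x | S (escal a x)] = ((a ^- edim)%:E * evol S)%E;
  evol_ball_lty : (evol [set x | (enrm x <= 1)%R] < +oo)%E;
  evol_ball_gt0 : (0 < evol [set x | (enrm x <= 1)%R])%E
}.

Section Basics.
Context {R : realType}.

Lemma measurable_preim d1 d2 (T1 : measurableType d1) (T2 : measurableType d2)
    (f : T1 -> T2) (S : set T2) :
  measurable_fun setT f -> measurable S -> measurable [set x | S (f x)].
Proof. by move=> mf mS; have := mf measurableT S mS; rewrite setTI. Qed.

Lemma measurable_le_fun d (T : measurableType d) (f g : T -> R) :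
  measurable_fun setT f -> measurable_fun setT g ->
  measurable [set x | f x <= g x].
Proof.
move=> mf mg.
have := measurable_fun_le measurableT mf mg; rewrite setTI; exact.
Qed.

Lemma measurable_lt_fun d (T : measurableType d) (f g : T -> R) :
  measurable_fun setT f -> measurable_fun setT g ->
  measurable [set x | f x < g x].
Proof.
move=> mf mg.
have -> : [set x | f x < g x] = ~` [set x | g x <= f x].
  by apply/seteqP; split=> x /=; rewrite ltNge => /negP.
exact/measurableC/measurable_le_fun.
Qed.

Lemma measurable_inv_ge0 d (T : measurableType d) (f : T -> R) :
  (forall x, 0 <= f x) -> measurable_fun setT f ->
  measurable_fun setT (fun x => (f x)^-1).
Proof.
move=> f0 mf; under eq_fun do rewrite -powR_inv1//.
exact: (@measurableT_comp _ _ _ _ _ _ (fun y => y `^ (-1)) setT f (@measurable_powR R (-1)) mf).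
Qed.

Section MeasurableComp.
Context d d' (T : measurableType d) (U : measurableType d') (X : euclid R T).
Implicit Types f g : U -> T.

Lemma measurable_eadd f g : measurable_fun setT f -> measurable_fun setT g ->
  measurable_fun setT (fun x => eadd X (f x) (g x)).
Proof.
move=> mf mg; apply: (@measurableT_comp _ _ _ _ _ _ (fun p => eadd X p.1 p.2)
  setT (fun x => (f x, g x)) (eadd_meas X)).
exact: measurable_fun_pair.
Qed.

Lemma measurable_eopp f : measurable_fun setT f ->
  measurable_fun setT (fun x => eopp X (f x)).
Proof. exact: measurableT_comp (eopp_meas X). Qed.

Lemma measurable_escal a f : measurable_fun setT f ->
  measurable_fun setT (fun x => escal X a (f x)).
Proof. exact: measurableT_comp (escal_meas X a). Qed.

Lemma measurable_enrm f : measurable_fun setT f ->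
  measurable_fun setT (fun x => enrm X (f x)).
Proof. exact: measurableT_comp (enrm_meas X). Qed.

End MeasurableComp.

Definition ball1 d (T : measurableType d) (X : euclid R T) : set T :=
  [set x | enrm X x <= 1].

Lemma measurable_ball1 d (T : measurableType d) (X : euclid R T) :
  measurable (ball1 X).
Proof. by apply: measurable_le_fun; [exact: enrm_meas|exact: measurable_cst]. Qed.

Definition rvol d (T : measurableType d) (X : euclid R T) : R :=
  fine (evol X (ball1 X)).

Lemma rvolE d (T : measurableType d) (X : euclid R T) :
  evol X (ball1 X) = (rvol X)%:E.
Proof.
rewrite /rvol fineK// ge0_fin_numE ?measure_ge0//; exact: evol_ball_lty.
Qed.

Lemma rvol_gt0 d (T : measurableType d) (X : euclid R T) : 0 < rvol X.
Proof. by rewrite -lte_fin -rvolE; exact: evol_ball_gt0. Qed.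

Lemma evol_nrm_le d (T : measurableType d) (X : euclid R T) r : 0 < r ->
  evol X [set x | enrm X x <= r] = (Num.sqrt r ^+ edim X * rvol X)%:E.
Proof.
move=> r0; have s0 : 0 < (Num.sqrt r)^-1 by rewrite invr_gt0 sqrtr_gt0.
have -> : [set x | enrm X x <= r] =
          [set x | ball1 X (escal X (Num.sqrt r)^-1 x)].
  apply/seteqP; split=> x; rewrite /ball1 /= enrm_scal exprVn sqr_sqrtr ?(ltW r0)//;
  by rewrite ler_pdivrMl// mulr1.
by rewrite evol_scal// ?rvolE ?exprVn ?invrK//; exact: measurable_ball1.
Qed.

Lemma lebesgue_measure_add (v : R) (S : set R) : measurable S ->
  lebesgue_measure [set x | S (v + x)] = lebesgue_measure S.
Proof.
move=> mS.
have mf : measurable_fun setT (+%R v : measurableTypeR R -> measurableTypeR R).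
  by apply: measurable_funD => //; exact: measurable_cst.
pose mf' := isMeasurableFun.Build _ _ _ _ _ mf.
pose f : {mfun measurableTypeR R >-> measurableTypeR R} := HB.pack (+%R v) mf'.
apply/esym.
apply: (@lebesgue_measure_unique R (pushforward lebesgue_measure f)) => //= _ [[a b]] _ <-.
rewrite /pushforward.
have -> : f @^-1` [set` Interval (BRight a) (BRight b)] = `]a - v, b - v]%classic.
  by apply/seteqP; split=> x /=; rewrite !in_itv/= ltrBlDl lerBrDl.
rewrite !lebesgue_measure_itv/= !lte_fin ltrD2r.
by case: ifP => // _; rewrite -!EFinB; congr EFin; lra.
Qed.

End Basics.

Section Line.
Context {R : realType}.

Lemma lebesgue_measure_scale (a : R) (S : set R) : 0 < a -> measurable S ->
  lebesgue_measure [set x | S (a * x)] = ((a ^- 1)%:E * lebesgue_measure S)%E.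
Proof.
move=> a0 mS; rewrite expr1.
have mf : measurable_fun setT ( *%R a : measurableTypeR R -> measurableTypeR R).
  by apply: measurable_funM => //; exact: measurable_cst.
pose mf' := isMeasurableFun.Build _ _ _ _ _ mf.
pose f : {mfun measurableTypeR R >-> measurableTypeR R} := HB.pack ( *%R a) mf'.
have a0' : (0 <= a) := ltW a0.
pose c : {nonneg R} := NngNum a0'.
have := @lebesgue_measure_unique R
  (mscale c (pushforward lebesgue_measure f)).
move=> /(_ mf) H; rewrite (H _ S mS) => [|_ [[b b'] _ <-]].
  by rewrite /mscale /= muleA -EFinM mulVf ?gt_eqF// mul1e.
pose I : set R := `]b / a, b' / a]%classic.
transitivity (a%:E * lebesgue_measure I)%E; last first.
  rewrite /mscale /pushforward; congr (_ * lebesgue_measure _)%E.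
  by apply/seteqP; split=> x; rewrite /I /= !in_itv/= ltr_pdivrMr// ler_pdivlMr// mulrC.
rewrite /I !lebesgue_measure_itv/= !lte_fin ltr_pM2r ?invr_gt0//.
case: ifP => _; rewrite ?mule0//.
by rewrite -!EFinB -EFinM -mulrBl mulrCA divff ?gt_eqF ?mulr1.
Qed.

Lemma lebesgue_square_ball :
  lebesgue_measure ([set x : R | x ^+ 2 <= 1] : set R) = 2%:E.
Proof.
rewrite (_ : [set x : R | x ^+ 2 <= 1] = `[-1, 1]%classic).
  rewrite lebesgue_measure_itv/= lte_fin ifT; last by lra.
  by rewrite -EFinB; congr EFin; lra.
apply/seteqP; split=> x /=; rewrite in_itv/= => h.
  by apply/andP; split; nra.
by case/andP: h => h1 h2; nra.
Qed.

Definition line_euclid : euclid R (measurableTypeR R).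
Proof.
refine (@Euclid R _ (measurableTypeR R) +%R -%R *%R (fun x => x ^+ 2) 1
  (@lebesgue_measure R)
  _ _ _ _ _ _ _ _ _ _ _ _ _).
- by apply: measurable_funD; [exact: measurable_fst|exact: measurable_snd].
- exact: oppr_measurable.
- by move=> a; exact: mulrl_measurable.
- exact: exprn_measurable.
- exact: addrC.
- by move=> x y; rewrite opprD subrK.
- by move=> x; rewrite sqrrN.
- by move=> a x; rewrite exprMn.
- by move=> x; exact: sqr_ge0.
- by move=> v S mS; exact: lebesgue_measure_add.
- by move=> a S a0 mS; exact: lebesgue_measure_scale.
- by rewrite /= lebesgue_square_ball ltry.
- by rewrite /= lebesgue_square_ball lte_fin.
Defined.

End Line.

(** * Products and transport of Euclidean spaces *)

Section Product.
Context {R : realType} d1 d2 (T1 : measurableType d1) (T2 : measurableType d2).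
Variables (X : euclid R T1) (Y : euclid R T2).
Local Open Scope ereal_scope.

(** Translations (factors 1) and dilations (factors [a ^- edim]) of a product are both instances.
    The inner integral gains [b] on each section; the outer one is a change of variables, the image
    of the volume under [f] being [a] times the volume. *)
Lemma prod_evol_preim (f : T1 -> T1) (g : T2 -> T2) (a b : R) :
  measurable_fun setT f -> measurable_fun setT g -> (0 <= a)%R -> (0 <= b)%R ->
  (forall S, measurable S -> evol X [set x | S (f x)] = a%:E * evol X S) ->
  (forall S, measurable S -> evol Y [set x | S (g x)] = b%:E * evol Y S) ->
  forall S : set (T1 * T2)%type, measurable S ->
    (evol X \x evol Y) [set p | S (f p.1, g p.2)] =
    (a * b)%:E * (evol X \x evol Y) S.
Proof.
move=> mf mg a0 b0 hf hg S mS.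
pose mf' := isMeasurableFun.Build _ _ _ _ _ mf.
pose F : {mfun T1 >-> T1} := HB.pack f mf'.
rewrite /product_measure1.
transitivity (\int[evol X]_x (b%:E * (evol Y (xsection S (f x))))).
  apply: eq_integral => x _ /=; rewrite -hg; last exact: measurable_xsection.
  by rewrite !xsectionE.
have mphi := measurable_fun_xsection (evol Y) mS.
rewrite ge0_integralZl//; last first.
  by move: mphi => /measurableT_comp/(_ mf); exact.
have := @ge0_integral_pushforward _ _ _ _ R F mf (evol X) setT
  (evol Y \o xsection S) measurableT mphi (fun _ _ => measure_ge0 _ _).
rewrite preimage_setT => <-.
have a0' : (0 <= a)%R := a0; pose c : {nonneg R} := NngNum a0'.
rewrite (_ : \int[_]_(_ in _) _ = \int[mscale c (evol X)]_x (evol Y \o xsection S) x).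
  rewrite ge0_integral_mscale//=.
  by rewrite EFinM [a%:E * b%:E]muleC muleA.
apply: eq_measure_integral => A mA _ /=; rewrite /pushforward /mscale /=.
exact: hf.
Qed.

Lemma prod_evolX A B : measurable A -> measurable B ->
  (evol X \x evol Y) (A `*` B) = evol X A * evol Y B.
Proof. exact: product_measure1E. Qed.

Lemma prod_sigma_finite : sigma_finite setT (evol X \x evol Y).
Proof.
have mle d (T : measurableType d) (Z : euclid R T) n :
    measurable [set x | enrm Z x <= n.+1%:R]%R.
  by apply: measurable_le_fun; [exact: enrm_meas|exact: measurable_cst].
exists (fun n => [set x | enrm X x <= n.+1%:R]%R `*` [set y | enrm Y y <= n.+1%:R]%R).
  apply/seteqP; split=> // -[x y] _.
  have [n hn] : exists n, (enrm X x + enrm Y y <= n.+1%:R)%R.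
    exists (Num.truncn (enrm X x + enrm Y y)).
    by rewrite ltW// truncnS_gt.
  have := enrm_ge0 X x; have := enrm_ge0 Y y => h1 h2.
  by exists n => //; split => /=; lra.
move=> n; split; first exact: measurableX.
rewrite prod_evolX//. by rewrite (evol_nrm_le X)// (evol_nrm_le Y)// -EFinM ltry.
Qed.

Definition prod_measure : {sigma_finite_measure set (T1 * T2)%type -> \bar R} :=
  HB.pack (evol X \x evol Y)
    (Measure_isSigmaFinite.Build _ _ _ _ prod_sigma_finite).

Definition prod_euclid : euclid R (T1 * T2)%type.
Proof.
refine (@Euclid R _ _ (fun p q => (eadd X p.1 q.1, eadd Y p.2 q.2))
  (fun p => (eopp X p.1, eopp Y p.2)) (fun a p => (escal X a p.1, escal Y a p.2))
  (fun p => enrm X p.1 + enrm Y p.2)%R (edim X + edim Y)%N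
  prod_measure
  _ _ _ _ _ _ _ _ _ _ _ _ _).
- by apply: measurable_fun_pair; apply: measurable_eadd; apply: measurableT_comp.
- by apply: measurable_fun_pair; apply: measurable_eopp.
- by move=> a; apply: measurable_fun_pair; apply: measurable_escal.
- by apply: measurable_funD; apply: measurable_enrm.
- by move=> x y; congr pair; exact: eaddC.
- by move=> x y /=; rewrite !eaddNK.
- by move=> x /=; rewrite !enrm_opp.
- by move=> a x /=; rewrite !enrm_scal mulrDr.
- by move=> x; rewrite addr_ge0 ?enrm_ge0.
- move=> v S mS.
  have := @prod_evol_preim (eadd X v.1) (eadd Y v.2) 1 1 _ _ ler01 ler01 _ _ S mS.
  rewrite mulr1 mul1e; apply.
  + by apply: measurable_eadd => //; exact: measurable_cst.
  + by apply: measurable_eadd => //; exact: measurable_cst.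
  + by move=> S' mS'; rewrite mul1e evol_add.
  + by move=> S' mS'; rewrite mul1e evol_add.
- move=> a S a0 mS.
  have := @prod_evol_preim (escal X a) (escal Y a) (a ^- edim X) (a ^- edim Y)
    (escal_meas _ _) (escal_meas _ _) _ _ _ _ S mS.
  rewrite -invfM -exprD; apply.
  + by rewrite invr_ge0 exprn_ge0// ltW.
  + by rewrite invr_ge0 exprn_ge0// ltW.
  + by move=> S' mS'; rewrite evol_scal.
  + by move=> S' mS'; rewrite evol_scal.
- apply: (@le_lt_trans _ _ ((evol X \x evol Y) (ball1 X `*` ball1 Y))).
    apply: le_measure; rewrite ?inE//.
    + apply: measurable_le_fun; last exact: measurable_cst.
      by apply: measurable_funD; apply: measurable_enrm.
    + by apply: measurableX; exact: measurable_ball1.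
    + move=> [x y] /=; rewrite /ball1 /= => h.
      by have := enrm_ge0 X x; have := enrm_ge0 Y y; split => /=; lra.
  rewrite prod_evolX; [|exact: measurable_ball1..].
  by rewrite !rvolE -EFinM ltry.
(* Squared norms add, so the product of two balls of squared radius 1/2 lies in the unit ball. *)
- apply: (@lt_le_trans _ _ ((evol X \x evol Y)
      ([set x | enrm X x <= 2^-1]%R `*` [set x | enrm Y x <= 2^-1]%R))).
    rewrite prod_evolX; last 2 first.
    + by apply: measurable_le_fun; [exact: enrm_meas|exact: measurable_cst].
    + by apply: measurable_le_fun; [exact: enrm_meas|exact: measurable_cst].
    rewrite (evol_nrm_le X) ?invr_gt0// (evol_nrm_le Y) ?invr_gt0// -EFinM lte_fin.
    by rewrite !mulr_gt0 ?rvol_gt0 ?exprn_gt0 ?sqrtr_gt0 ?invr_gt0.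
  apply: le_measure; rewrite ?inE//.
  + by apply: measurableX;
      (apply: measurable_le_fun; [exact: enrm_meas|exact: measurable_cst]).
  + apply: measurable_le_fun; last exact: measurable_cst.
    by apply: measurable_funD; apply: measurable_enrm.
  + by move=> [x y] /= [] /= h1 h2; lra.
Defined.

End Product.

Section Transport.
Context {R : realType} d1 d2 (T1 : measurableType d1) (T2 : measurableType d2).
Variables (X : euclid R T1) (f : T1 -> T2) (g : T2 -> T1).
Hypotheses (mf : measurable_fun setT f) (mg : measurable_fun setT g).
Hypothesis fK : cancel f g.

Let pushm : {measure set T2 -> \bar R} :=
  measure_function_pushforward__canonical__measure_function_Measure (evol X) mf.

Lemma transport_sigma_finite : sigma_finite setT pushm.
Proof.
have [G GT Gfin] := sigma_finiteT (evol X).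
exists (fun n => [set y | G n (g y)]).
  apply/seteqP; split=> // y _.
  have : [set: T1] (g y) by [].
  by rewrite GT => -[n _ Gn]; exists n.
move=> n; have [mG Goo] := Gfin n; split; first exact: measurable_preim.
rewrite /pushm /= /pushforward /=.
have -> : f @^-1` [set y | G n (g y)] = G n; last exact: Goo.
by apply/seteqP; split=> x /=; rewrite fK.
Qed.

Definition transport_measure : {sigma_finite_measure set T2 -> \bar R} :=
  HB.pack (Measure.sort pushm)
    (Measure_isSigmaFinite.Build _ _ _ _ transport_sigma_finite).

Lemma transport_measureE A : transport_measure A = evol X [set x | A (f x)].
Proof. by []. Qed.

Definition transport_euclid : euclid R T2.
Proof.
refine (@Euclid R _ _ (fun p q => f (eadd X (g p) (g q))) (fun p => f (eopp X (g p)))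
  (fun a p => f (escal X a (g p))) (fun p => enrm X (g p)) (edim X)
  transport_measure _ _ _ _ _ _ _ _ _ _ _ _ _).
- apply: (measurableT_comp mf); apply: measurable_eadd;
  exact: measurableT_comp.
- by apply: (measurableT_comp mf); apply: measurable_eopp.
- by move=> a; apply: (measurableT_comp mf); apply: measurable_escal.
- by apply: measurable_enrm.
- by move=> x y; rewrite eaddC.
- by move=> x y /=; rewrite !fK eaddNK.
- by move=> x /=; rewrite fK enrm_opp.
- by move=> a x /=; rewrite fK enrm_scal.
- by move=> x; rewrite enrm_ge0.
- move=> v S mS; rewrite !transport_measureE /=.
  under eq_set do rewrite fK.
  by apply: (@evol_add _ _ _ X (g v) [set x | S (f x)]); exact: measurable_preim.
- move=> a S a0 mS; rewrite !transport_measureE /=.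
  under eq_set do rewrite fK.
  by apply: (@evol_scal _ _ _ X a [set x | S (f x)]) => //; exact: measurable_preim.
- rewrite transport_measureE /=; under eq_set do rewrite fK.
  exact: evol_ball_lty.
- rewrite transport_measureE /=; under eq_set do rewrite fK.
  exact: evol_ball_gt0.
Defined.

End Transport.

(** * Lebesgue measure on tuples and invariance under isometries *)

Section Tuples.
Context {R : realType}.

Definition tuple0_euclid : euclid R (0.-tuple R).
Proof.
refine (@Euclid R _ _ (fun _ _ => [tuple]) (fun _ => [tuple])
  (fun _ _ => [tuple]) (fun _ => 0) 0 (\d_([tuple] : 0.-tuple R))
  _ _ _ _ _ _ _ _ _ _ _ _ _).
- exact: measurable_cst.
- exact: measurable_cst.
- by move=> a; exact: measurable_cst.
- exact: measurable_cst.
- by [].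
- by [].
- by [].
- by move=> *; rewrite mulr0.
- by [].
- move=> v S mS; congr (\d_ _ _)%E.
  by apply/seteqP; split=> t /=; rewrite (tuple0 t).
- move=> a S a0 mS; rewrite expr0 invr1 mul1e; congr (\d_ _ _)%E.
  by apply/seteqP; split=> t /=; rewrite (tuple0 t).
- by rewrite /= diracE; case: (_ \in _); rewrite ltry.
- by rewrite /= diracE mem_set ?lte_fin//= ler01.
Defined.

Definition tcons k (p : measurableTypeR R * k.-tuple R) : k.+1.-tuple R :=
  cons_tuple p.1 p.2.

Definition tuncons k (t : k.+1.-tuple R) : measurableTypeR R * k.-tuple R :=
  (thead t, [tuple of behead t]).

Lemma tconsK k : cancel (@tcons k) (@tuncons k).
Proof. by move=> [u t]; congr pair; exact/val_inj. Qed.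

Lemma measurable_tcons k : measurable_fun setT (@tcons k).
Proof.
apply: (@measurable_cons _ _ _ R (fun p : measurableTypeR R * k.-tuple R => p.1) k snd); last by [].
exact: (@measurable_fst _ _ (measurableTypeR R) _).
Qed.

Lemma measurable_tuncons k : measurable_fun setT (@tuncons k).
Proof.
apply: measurable_fun_pair; last exact: measurable_behead.
exact: (@measurable_tnth _ (R : measurableType _) k.+1 ord0).
Qed.

Lemma tnth_tcons k p (j : 'I_k) : tnth (@tcons k p) (lift ord0 j) = tnth p.2 j.
Proof. exact: tnthS. Qed.

Lemma tnth_tuncons k t (j : 'I_k) : tnth (tuncons t).2 j = tnth t (lift ord0 j).
Proof. by rewrite [in RHS](tuple_eta t) tnthS. Qed.

(** The recursion copies that of [lebesgue_tuple], a line times a shorter tuple, so that the two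
    volumes agree almost by unfolding. *)
Fixpoint tuple_euclid k : euclid R (k.-tuple R) :=
  match k with
  | 0 => tuple0_euclid
  | k'.+1 => transport_euclid (prod_euclid line_euclid (tuple_euclid k'))
      (@measurable_tcons k') (@measurable_tuncons k') (@tconsK k')
  end.

Lemma edim_tuple k : edim (tuple_euclid k) = k.
Proof. by elim: k => //= k ->. Qed.

Lemma enrm_tuple k t : enrm (tuple_euclid k) t = \sum_(i < k) tnth t i ^+ 2.
Proof.
elim: k t => [t|k IH t]; first by rewrite big_ord0.
rewrite /= IH big_ord_recl; congr (_ + _); apply: eq_bigr => i _.
exact: (congr1 (fun a => a ^+ 2) (tnth_tuncons t i)).
Qed.

Lemma tnth_eadd k t t' i :
  tnth (eadd (tuple_euclid k) t t') i = tnth t i + tnth t' i.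
Proof.
elim: k t t' i => [|k IH] t t' i; first by case: i.
have [j ->|->] := unliftP ord0 i; last by [].
by rewrite tnth_tcons IH !tnth_tuncons.
Qed.

Lemma tnth_escal k a t i : tnth (escal (tuple_euclid k) a t) i = a * tnth t i.
Proof.
elim: k t i => [|k IH] t i; first by case: i.
have [j ->|->] := unliftP ord0 i; last by [].
by rewrite tnth_tcons IH tnth_tuncons.
Qed.

Lemma evol_tuple k A : measurable A -> evol (tuple_euclid k) A = lebesgue_tuple A.
Proof.
elim: k A => [|k IH] A mA //.
transitivity ((evol line_euclid \x evol (tuple_euclid k))%E [set p | A (tcons p)]).
  by [].
apply: eq_integral => u _; rewrite [LHS]/= xsectionE; apply: IH.
apply: (@measurable_preim _ _ _ _ (fun t => tcons (u, t))) mA.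
apply: (measurableT_comp (@measurable_tcons k)).
by apply: measurable_fun_pair => //; exact: measurable_cst.
Qed.

End Tuples.

(** * Volumes under additive isometries *)

Section Haar.
Context {R : realType} d1 d2 (T1 : measurableType d1) (T2 : measurableType d2).
Variables (X : euclid R T1) (Y : euclid R T2) (f : T1 -> T2).
Hypothesis mf : measurable_fun setT f.
Hypothesis f_add : forall x y, f (eadd X x y) = eadd Y (f x) (f y).
Hypothesis f_surj : forall y, exists x, f x = y.
Hypothesis f_nrm : forall x, enrm Y (f x) = enrm X x.
Local Open Scope ereal_scope.

(* Tonelli on the set of the (x, y) such that f x lies in S and y - f x lies
   in the unit ball: both iterated integrals can be computed by translation
   invariance. *)
Lemma evol_isometry S : measurable S ->
  evol X [set x | S (f x)] * (rvol Y)%:E = evol Y S * (rvol X)%:E.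
Proof.
move=> mS.
pose W : set (T1 * T2) :=
  [set p | S (f p.1) /\ ball1 Y (eadd Y (eopp Y (f p.1)) p.2)].
have mfx : measurable_fun setT (fun p : T1 * T2 => f p.1).
  exact: measurableT_comp.
have mW : measurable W.
  apply: measurableI; first exact: measurable_preim.
  apply: (measurable_preim _ (measurable_ball1 Y)).
  by apply: measurable_eadd => //; exact: measurable_eopp.
(* On the section over y, translating x by a preimage of y turns W into V: the first condition
   becomes S (f x + y), and -(y + f x) + y = -f x has the norm of x. In V, each x of the ball sees a
   translate of S. *)
pose V : set (T1 * T2) :=
  [set p | ball1 X p.1 /\ S (eadd Y (f p.1) p.2)].
have mV : measurable V.
  apply: measurableI.
    by apply: (measurable_preim _ (measurable_ball1 X)).
  by apply: (measurable_preim _ mS); exact: measurable_eadd.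
have swap (A : set (T1 * T2)) : measurable A ->
    (evol X \x evol Y) A = (evol X \x^ evol Y) A.
  move=> mA.
  rewrite /product_measure1 /product_measure2.
  have := indic_fubini_tonelli (evol X) (evol Y) mA.
  by rewrite indic_fubini_tonelli_FE// indic_fubini_tonelli_GE.
transitivity ((evol X \x evol Y) W).
  rewrite /product_measure1.
  transitivity (\int[evol X]_x ((\1_[set x | S (f x)] x)%:E * (rvol Y)%:E)).
    rewrite ge0_integralZr//.
    - by rewrite integral_indic ?setIT//; exact: measurable_preim.
    - by apply/measurable_EFinP; apply: measurable_indic; exact: measurable_preim.
    - by rewrite lee_fin ltW ?rvol_gt0.
  apply: eq_integral => x _ /=; rewrite xsectionE indicE.
  have [Sx|nSx] := pselect (S (f x)).
    rewrite mem_set// mul1e -rvolE -(evol_add Y (eopp Y (f x))).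
      by congr (evol Y _); apply/seteqP; split=> y /= [].
    exact: measurable_ball1.
  rewrite memNset// mul0e (_ : _ @^-1` _ = set0) ?measure0//.
  by apply/seteqP; split=> y //= [].
transitivity ((evol X \x^ evol Y) V).
  rewrite swap// /product_measure2; apply: eq_integral => y _ /=.
  have [v hv] := f_surj y.
  rewrite -(evol_add X v); last exact: measurable_ysection.
  congr (evol X _); rewrite !ysectionE; apply/seteqP; split=> x;
    by rewrite /W /V /= f_add hv (eaddC Y y) eaddNK /ball1 /= enrm_opp f_nrm => -[? ?].
rewrite -swap// /product_measure1.
transitivity (\int[evol X]_x (evol Y S * (\1_(ball1 X) x)%:E)).
  apply: eq_integral => x _ /=; rewrite xsectionE indicE.
  have [Bx|nBx] := pselect (ball1 X x).
    rewrite mem_set// mule1 -(evol_add Y (f x) mS).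
    by congr (evol Y _); apply/seteqP; split=> y /= // -[].
  rewrite memNset// mule0 (_ : _ @^-1` _ = set0) ?measure0//.
  by apply/seteqP; split=> y //= [].
rewrite ge0_integralZl//.
- rewrite integral_indic ?setIT; [by rewrite -rvolE|by []|exact: measurable_ball1].
- apply/measurable_EFinP; apply: measurable_indic; exact: measurable_ball1.
Qed.

(** Stated as a proportion of the unit ball, so that the constant relating the two volumes
    disappears. Infinite values of [evol Y S] are excluded because its product with [rvol X] is
    finite. *)
Lemma evol_isometry_ratio S (a : R) : measurable S ->
  evol X [set x | S (f x)] = (a * rvol X)%:E -> evol Y S = (a * rvol Y)%:E.
Proof.
move=> mS h; have := evol_isometry mS; rewrite h.
have rX := rvol_gt0 X.
case: (evol Y S) => [s| |].
- rewrite -!EFinM => -[e]; congr EFin; apply: (mulIf (lt0r_neq0 rX)).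
  by rewrite -e mulrAC.
- by rewrite mulyr gtr0_sg// mul1e -EFinM.
- by rewrite mulNyr gtr0_sg// mul1e -EFinM.
Qed.

End Haar.

(** * Complex coordinates *)

Section Complex.
Context {R : realType}.
Local Notation C := R[i].

(** The squared modulus is polynomial in the coordinates, which keeps square roots out of most of
    the algebra and measurability. *)
Definition cn2 (z : C) : R := complex.Re z ^+ 2 + complex.Im z ^+ 2.

Lemma cn2_ge0 z : 0 <= cn2 z.
Proof. by rewrite addr_ge0 ?sqr_ge0. Qed.

Lemma cn2M z w : cn2 (z * w) = cn2 z * cn2 w.
Proof. by case: z w => [a b] [c d]; rewrite /cn2 /=; ring. Qed.

Lemma cn2_eq0 z : (cn2 z == 0) = (z == 0).
Proof. by case: z => a b; rewrite /cn2 /= paddr_eq0 ?sqr_ge0// !sqrf_eq0 eq_complex. Qed.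

Lemma cn2_real a : cn2 a%:C%C = a ^+ 2.
Proof. by rewrite /cn2 /= expr0n addr0. Qed.

Lemma mul_conjc z : z * conjc z = (cn2 z)%:C%C.
Proof.
case: z => a b; apply/eqP; rewrite eq_complex /cn2 /=.
by apply/andP; split; apply/eqP; ring.
Qed.

Lemma cn20 : cn2 0 = 0.
Proof. by rewrite /cn2 /= expr0n addr0. Qed.

Lemma cn21 : cn2 1 = 1.
Proof. by rewrite /cn2 /= expr0n addr0 expr1n. Qed.

Lemma cn2X z k : cn2 (z ^+ k) = cn2 z ^+ k.
Proof. by elim: k => [|k IH]; rewrite ?cn21// !exprS cn2M IH. Qed.

Lemma normcE2 z : normc z = Num.sqrt (cn2 z).
Proof. by case: z. Qed.

Lemma normc_sq z : normc z ^+ 2 = cn2 z.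
Proof. by rewrite normcE2 sqr_sqrtr// cn2_ge0. Qed.

Section Measurability.
Context d (T : measurableType d).
Implicit Types f g : T -> C.

Definition cmeas f := measurable_fun setT (fun x => complex.Re (f x)) /\
                      measurable_fun setT (fun x => complex.Im (f x)).

Lemma cmeas_cst z : cmeas (fun=> z).
Proof. by split; exact: measurable_cst. Qed.

Lemma cmeasD f g : cmeas f -> cmeas g -> cmeas (fun x => f x + g x).
Proof.
move=> [f1 f2] [g1 g2]; split.
- apply: (eq_measurable_fun (fun x => complex.Re (f x) + complex.Re (g x))).
    by move=> x _; case: (f x) (g x) => ? ? [].
  exact: measurable_funD.
- apply: (eq_measurable_fun (fun x => complex.Im (f x) + complex.Im (g x))).
    by move=> x _; case: (f x) (g x) => ? ? [].
  exact: measurable_funD.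
Qed.

Lemma cmeasM f g : cmeas f -> cmeas g -> cmeas (fun x => f x * g x).
Proof.
move=> [f1 f2] [g1 g2]; split.
- apply: (eq_measurable_fun (fun x => complex.Re (f x) * complex.Re (g x) -
                                      complex.Im (f x) * complex.Im (g x))).
    by move=> x _; case: (f x) (g x) => ? ? [].
  by apply: measurable_funB; exact: measurable_funM.
- apply: (eq_measurable_fun (fun x => complex.Re (f x) * complex.Im (g x) +
                                      complex.Im (f x) * complex.Re (g x))).
    by move=> x _; case: (f x) (g x) => ? ? [].
  by apply: measurable_funD; exact: measurable_funM.
Qed.

Lemma cmeas_sum (I : Type) (r : seq I) (P : pred I) (F : I -> T -> C) :
  (forall i, cmeas (F i)) -> cmeas (fun x => \sum_(i <- r | P i) F i x).
Proof.
move=> mF; elim: r => [|i r IH].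
  by under [X in cmeas X]eq_fun do rewrite big_nil; exact: cmeas_cst.
under [X in cmeas X]eq_fun do rewrite big_cons.
by case: (P i) => //; exact: cmeasD.
Qed.

Lemma cmeas_prod (I : Type) (r : seq I) (P : pred I) (F : I -> T -> C) :
  (forall i, cmeas (F i)) -> cmeas (fun x => \prod_(i <- r | P i) F i x).
Proof.
move=> mF; elim: r => [|i r IH].
  by under [X in cmeas X]eq_fun do rewrite big_nil; exact: cmeas_cst.
under [X in cmeas X]eq_fun do rewrite big_cons.
by case: (P i) => //; exact: cmeasM.
Qed.

Lemma cmeas_det k (F : T -> 'M[C]_k) :
  (forall i j, cmeas (fun x => F x i j)) -> cmeas (fun x => \det (F x)).
Proof.
move=> mF; apply: cmeas_sum => s; apply: cmeasM; first exact: cmeas_cst.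
by apply: cmeas_prod => i; exact: mF.
Qed.

Lemma cmeas_mulmx p q s (F : T -> 'M[C]_(p, q)) (G : T -> 'M[C]_(q, s)) :
  (forall i j, cmeas (fun x => F x i j)) -> (forall i j, cmeas (fun x => G x i j)) ->
  forall i j, cmeas (fun x => (F x *m G x) i j).
Proof.
move=> mF mG i j; under [X in cmeas X]eq_fun do rewrite mxE.
by apply: cmeas_sum => l; exact: cmeasM.
Qed.

Lemma measurable_cn2 f : cmeas f -> measurable_fun setT (fun x => cn2 (f x)).
Proof. by move=> [f1 f2]; apply: measurable_funD; exact: measurable_funX. Qed.

End Measurability.

Lemma cmeas_comp d d' (T : measurableType d) (U : measurableType d')
    (f : T -> C) (h : U -> T) :
  cmeas f -> measurable_fun setT h -> cmeas (fun x => f (h x)).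
Proof. by move=> [f1 f2] mh; split; [exact: (measurableT_comp f1 mh)|exact: (measurableT_comp f2 mh)]. Qed.

(** The index type is that of [realvec], so that the vectorization of a perturbation is an instance
    of [enc]. *)
Definition cspace (K : finType) := #|{: K * bool}|.-tuple R.

Definition dec (K : finType) (t : cspace K) (i : K) : C :=
  Complex (tnth t (enum_rank (i, false))) (tnth t (enum_rank (i, true))).

Definition enc (K : finType) (z : K -> C) : cspace K :=
  codom_tuple (fun p : K * bool =>
    if p.2 then complex.Im (z p.1) else complex.Re (z p.1)).

Lemma tnth_enc (K : finType) (z : K -> C) i b :
  tnth (enc z) (enum_rank (i, b)) = if b then complex.Im (z i) else complex.Re (z i).
Proof. by rewrite (tnth_nth 0) nth_image enum_rankK. Qed.

Lemma encK (K : finType) (z : K -> C) i : dec (enc z) i = z i.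
Proof. by rewrite /dec !tnth_enc; case: (z i). Qed.

Lemma dec_inj (K : finType) (t t' : cspace K) : (forall i, dec t i = dec t' i) -> t = t'.
Proof.
move=> h; apply: eq_from_tnth => j; rewrite -(enum_valK j).
by case: (enum_val j) => i [] /=; have [] := h i.
Qed.

Lemma cmeas_dec (K : finType) i : cmeas (fun t : cspace K => dec t i).
Proof. by rewrite /cmeas /dec /=; split; exact: (@measurable_tnth _ (R : measurableType _)). Qed.

Lemma measurable_enc d (T : measurableType d) (K : finType) (f : T -> K -> C) :
  (forall i, cmeas (fun x => f x i)) -> measurable_fun setT (fun x => enc (f x)).
Proof.
move=> mf; apply/measurable_fun_tnthP => j.
rewrite -(enum_valK j); case: (enum_val j) => i b /=.
apply: (eq_measurable_fun (fun x => if b then complex.Im (f x i)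
                                    else complex.Re (f x i))).
  by move=> x _ /=; rewrite tnth_enc.
by case: b; have [] := mf i.
Qed.

Definition ceuclid K : euclid R (cspace K) := tuple_euclid _.

Lemma dec_add K (t t' : cspace K) i :
  dec (eadd (ceuclid K) t t') i = dec t i + dec t' i.
Proof. by rewrite /dec !tnth_eadd. Qed.

Lemma dec_scal K a (t : cspace K) i :
  dec (escal (ceuclid K) a t) i = a%:C%C * dec t i.
Proof.
rewrite /dec !tnth_escal; apply/eqP; rewrite eq_complex /=.
by rewrite !mul0r subr0 addr0 !eqxx.
Qed.

Lemma sum_pair_bool (K : finType) (F : K * bool -> R) :
  \sum_p F p = \sum_i (F (i, false) + F (i, true)).
Proof.
rewrite (eq_bigr (fun p => F (p.1, p.2))); last by case.
rewrite -(pair_bigA _ (fun i b => F (i, b))) /=; apply: eq_bigr => i _.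
by rewrite big_bool addrC.
Qed.

Lemma enrm_cspace K (t : cspace K) : enrm (ceuclid K) t = \sum_i cn2 (dec t i).
Proof.
rewrite enrm_tuple (reindex (@enum_rank {: K * bool})) /=; last first.
  by apply: onW_bij; exact: enum_rank_bij.
exact: (sum_pair_bool (fun p => tnth t (enum_rank p) ^+ 2)).
Qed.

Lemma edim_cspace K : edim (ceuclid K) = (#|K| * 2)%N.
Proof. by rewrite edim_tuple card_prod card_bool. Qed.

End Complex.
Arguments cspace R K : clear implicits.

(** * The law of one coordinate of a point of the ball *)

Section Disc.
Context {R : realType} d (T : measurableType d) (X : euclid R T) (q : nat).
Hypothesis dimX : edim X = (q * 2)%N.
Let Y : euclid R _ := ceuclid unit.
Let P := prod_euclid X Y.

(** In real dimension two the area is proportional to the squared radius [r]. The maximum covers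
    negative [r], where the disc is empty; for [r] = 0 the origin lies in discs of arbitrarily small
    area. *)
Lemma evol_disc (r : R) : evol Y [set w | enrm Y w <= r] = (Num.max 0 r * rvol Y)%:E.
Proof.
have dimY : edim Y = 2%N by rewrite edim_cspace card_unit.
have pos s : 0 < s -> evol Y [set w | enrm Y w <= s] = (s * rvol Y)%:E.
  by move=> s0; rewrite evol_nrm_le// dimY sqr_sqrtr// ltW.
have [r0|r0|<-] := ltgtP 0 r; first exact: pos.
  rewrite mul0r (_ : [set w | _] = set0) ?measure0//.
  by apply/seteqP; split=> w //=; have := enrm_ge0 Y w; lra.
rewrite mul0r; apply/eqP; rewrite eq_le measure_ge0 andbT.
apply/lee_addgt0Pr => e e0; rewrite add0e.
have V0 : 0 < rvol Y := rvol_gt0 Y.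
have -> : e = e / rvol Y * rvol Y by rewrite divfK// gt_eqF.
rewrite -pos ?divr_gt0//; apply: le_measure; rewrite ?inE.
- by apply: measurable_le_fun; [exact: enrm_meas|exact: measurable_cst].
- by apply: measurable_le_fun; [exact: enrm_meas|exact: measurable_cst].
- by move=> w /= h; rewrite (le_trans h)// divr_ge0// ltW.
Qed.

(* In the fibre over x the set is a disc, whose area and that of the disc of
   squared radius 1 - enrm x / (1 - tau) add up to the area of the whole fibre;
   the second discs together form the unit ball shrunk in the direction of x. *)
Lemma evol_disc_tail (tau : R) : (0 < q)%N -> 0 <= tau <= 1 ->
  evol P [set p | enrm P p <= 1 /\ enrm Y p.2 <= tau * enrm P p] =
  ((1 - (1 - tau) ^+ q) * rvol P)%:E.
Proof.
move=> q0 /andP[t0]; rewrite le_eqVlt => /predU1P[->|t1].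
  rewrite subrr expr0n gtn_eqF// subr0 mul1r -rvolE; congr (evol P _).
  apply/seteqP; split=> p; rewrite /ball1 /=; first by case.
  by move=> h; split=> //; rewrite mul1r lerDr enrm_ge0.
have s0 : 0 < 1 - tau by lra.
pose c := (Num.sqrt (1 - tau))^-1.
have c0 : 0 < c by rewrite invr_gt0 sqrtr_gt0.
have c2 : c ^+ 2 = (1 - tau)^-1 by rewrite exprVn sqr_sqrtr// ltW.
set S := [set p | _].
pose S' : set (T * cspace R unit) := [set p | ball1 P (escal X c p.1, p.2)].
have mB := measurable_ball1 P.
have mS : measurable S.
  apply: measurableI; first exact: mB.
  apply: measurable_le_fun; first exact: measurable_enrm.
  by apply: measurable_funM; [exact: measurable_cst|exact: measurable_enrm].
have mS' : measurable S'.
  apply: (measurable_preim _ mB); apply: measurable_fun_pair => //.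
  exact: measurable_escal.
have volS' : evol P S' = ((1 - tau) ^+ q * rvol P)%:E.
  have := @prod_evol_preim R _ _ T _ X Y (escal X c) id ((1 - tau) ^+ q) 1.
  move=> /(_ (escal_meas X c) (@measurable_id _ _ _)) H.
  rewrite [LHS](H _ _ _ _ _ mB)//.
  - by rewrite mulr1 -[((evol X \x evol Y) (ball1 P))%E]/(evol P (ball1 P)) rvolE.
  - by rewrite exprn_ge0// ltW.
  - move=> A mA; rewrite evol_scal// dimX mulnC exprM c2 exprVn invrK//.
  - by move=> A mA; rewrite mul1e.
have add : (evol P S + evol P S' = (rvol P)%:E)%E.
  rewrite -rvolE.
  change ((evol X \x evol Y) S + (evol X \x evol Y) S' =
          (evol X \x evol Y) (ball1 P))%E.
  rewrite /product_measure1.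
  rewrite -ge0_integralD//; last 2 first.
    exact: measurable_fun_xsection.
    exact: measurable_fun_xsection.
  apply: eq_integral => x _ /=; rewrite !xsectionE.
  have := enrm_ge0 X x; set a := enrm X x => a0.
  rewrite (_ : _ @^-1` S =
      [set w | enrm Y w <= Num.min (1 - a) (tau * a / (1 - tau))]); last first.
    apply/seteqP; split=> w; rewrite /S /= le_min ler_pdivlMr// -/a.
      by move=> [h1 h2]; apply/andP; split; nra.
    by move=> /andP[h1 h2]; split; nra.
  rewrite (_ : _ @^-1` S' = [set w | enrm Y w <= 1 - a / (1 - tau)]); last first.
    apply/seteqP; split=> w; rewrite /S' /ball1 /= enrm_scal c2 -/a mulrC; lra.
  rewrite (_ : _ @^-1` _ = [set w | enrm Y w <= 1 - a]); last first.
    by apply/seteqP; split=> w; rewrite /ball1 /= -/a; lra.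
  rewrite !evol_disc -EFinD -mulrDl; congr (_ * _)%:E.
  (* With b = a / (1 - tau), which is at least a, the areas add up because max(0, min(1 - a, b - a))
     + max(0, 1 - b) = max(0, 1 - a). *)
  have e1 : tau * a / (1 - tau) = a / (1 - tau) - a.
    by field; rewrite gt_eqF.
  rewrite e1; set b := a / (1 - tau).
  have ab : a <= b by rewrite ler_pdivlMr//; nra.
  rewrite /Num.min; case: (ltP (1 - a) (b - a)) => h; rewrite /Num.max.
    by (repeat case: ltP => ?); lra.
  by (repeat case: ltP => ?); lra.
have fS : evol P S \is a fin_num.
  rewrite ge0_fin_numE ?measure_ge0//; apply: (@le_lt_trans _ _ (rvol P)%:E).
    by rewrite -add leeDl.
  by rewrite ltry.
move: add; rewrite volS' -(fineK fS) -EFinD => -[e]; congr EFin; lra.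
Qed.

End Disc.

(** * Completing orthonormal families to unitary coordinates *)

Section Unitary.
Context {R : realType}.
Local Notation C := R[i].

Lemma ctmxM p q s (A : 'M[C]_(p, q)) (B : 'M[C]_(q, s)) :
  ctmx (A *m B) = ctmx B *m ctmx A.
Proof. by rewrite /ctmx map_mxM trmx_mul. Qed.

Lemma ctmxK p q (A : 'M[C]_(p, q)) : ctmx (ctmx A) = A.
Proof. by apply/matrixP => i j; rewrite !mxE conjcK. Qed.

Lemma ctmx_spectral p q (A : 'M[C]_(p, q)) : map_mx Num.conj A^T = ctmx A.
Proof. by apply/matrixP => i j; rewrite !mxE. Qed.

(** The orthogonal complement of the rows of [L] is the kernel of [ctmx L], and Schmidt
    orthonormalisation of a basis of it gives [W]. The given rows go to the bottom, on which
    [unitary_last] relies. *)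
Lemma unitary_completion j n (L : 'M[C]_(j, n)) : L *m ctmx L = 1%:M ->
  exists p (W : 'M[C]_(p, n)), (p + j)%N = n /\
    col_mx W L *m ctmx (col_mx W L) = 1%:M.
Proof.
move=> hL.
have uL : L \is unitarymx by apply/unitarymxP; rewrite ctmx_spectral.
have rL : \rank L = j by exact: mxrank_unitary.
pose K := kermx (ctmx L).
have rK : (\rank K + j = n)%N.
  rewrite /K mxrank_ker /ctmx mxrank_tr mxrank_map rL subnK//.
  by rewrite -rL rank_leq_col.
pose W := schmidt (row_base K).
have uW : W *m ctmx W = 1%:M.
  rewrite -ctmx_spectral; apply/unitarymxP/schmidt_unitarymx.
  exact: rank_leq_col.
have WL : W *m ctmx L = 0.
  apply/sub_kermxP; rewrite /W eqmx_schmidt_free ?row_base_free//.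
  by rewrite eq_row_base.
have LW : L *m ctmx W = 0.
  by rewrite -[LHS]ctmxK ctmxM ctmxK WL /ctmx map_mx0 trmx0.
exists (\rank K), W; split=> //.
rewrite /ctmx map_col_mx tr_col_mx mul_col_row.
rewrite -/(ctmx W) -/(ctmx L) uW hL WL LW.
by rewrite -scalar_mx_block.
Qed.

(** The unitary completion on arbitrary finite index types: the orthonormal linear forms [L j]
    become the coordinates [a], the others are collected in [e], and f rebuilds the vector from
    both. *)
Lemma isometry_extension (J K : finType) (L : J -> K -> C) :
  (forall j j', \sum_k L j k * conjc (L j' k) = (j == j')%:R) ->
  exists p (W : 'I_p -> K -> C), (p + #|J|)%N = #|K| /\
    let f (a : J -> C) (e : 'I_p -> C) k :=
      \sum_j a j * conjc (L j k) + \sum_i e i * conjc (W i k) in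
    [/\ forall a e j, \sum_k L j k * f a e k = a j,
        forall a e, \sum_k cn2 (f a e k) = \sum_j cn2 (a j) + \sum_i cn2 (e i)
      & forall z : K -> C, exists a e, forall k, f a e k = z k].
Proof.
move=> hL.
pose M : 'M[C]_(#|J|, #|K|) := \matrix_(j, k) L (enum_val j) (enum_val k).
have hM : M *m ctmx M = 1%:M.
  apply/matrixP => j j'; rewrite !mxE.
  rewrite -(inj_eq enum_val_inj) -hL [RHS](reindex (@enum_val K predT)) /=.
    by apply: eq_bigr => k _; rewrite !mxE.
  by apply: onW_bij; exact: enum_val_bij.
have [p [W [e1 hW]]] := unitary_completion hM.
exists p, (fun i k => W i (enum_rank k)); split=> // f.
pose V := col_mx W M.
have hV : V *m ctmx V = 1%:M := hW.
have hV' : ctmx V *m V = 1%:M.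
  (* Eliminating the dimension equation makes [V] square, so that its right inverse is also a left
     inverse. *)
  move: V hV {hW f}; clearbody M; case: _ / e1 M W {hM} => M W V hV.
  exact: mulmx1C hV.
pose vec (a : J -> C) (e : 'I_p -> C) : 'cV[C]_(p + #|J|) :=
  col_mx (\col_i e i) (\col_j a (enum_val j)).
have fE a e k : f a e k = (ctmx V *m vec a e) (enum_rank k) 0.
  rewrite /ctmx /V map_col_mx tr_col_mx mul_row_col mxE addrC /f; congr (_ + _).
    rewrite !mxE [LHS](reindex (@enum_val J predT)) /=; last first.
      by apply: onW_bij; exact: enum_val_bij.
    by apply: eq_bigr => i _; rewrite !mxE enum_rankK mulrC.
  by rewrite !mxE; apply: eq_bigr => i _; rewrite !mxE mulrC.
have sumK (F : K -> C) : \sum_k F k = \sum_(k < #|K|) F (enum_val k).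
  rewrite [LHS](reindex (@enum_val K predT)) /=; first by [].
  by apply: onW_bij; exact: enum_val_bij.
have norm q (u : 'cV[C]_q) : (ctmx u *m u) 0 0 = (\sum_i cn2 (u i 0))%:C%C.
  rewrite mxE rmorph_sum; apply: eq_bigr => i _.
  by rewrite !mxE mulrC mul_conjc.
split.
- move=> a e j; pose y := ctmx V *m vec a e.
  have -> : \sum_k L j k * f a e k = (M *m y) (enum_rank j) 0.
    rewrite sumK mxE; apply: eq_bigr => k _.
    by rewrite fE !mxE enum_rankK enum_valK.
  have -> : M *m y = dsubmx (V *m y) by rewrite mul_col_mx col_mxKd.
  by rewrite /y mulmxA hV mul1mx col_mxKd mxE enum_rankK.
- move=> a e; apply: complexI; pose y := ctmx V *m vec a e.
  have -> : (\sum_k cn2 (f a e k))%:C%C = (ctmx y *m y) 0 0.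
    rewrite norm rmorph_sum/= sumK rmorph_sum/=; apply: eq_bigr => k _.
    by rewrite fE enum_valK.
  rewrite /y ctmxM ctmxK -mulmxA (mulmxA V) hV mul1mx norm.
  congr (_%:C)%C; rewrite big_split_ord /= addrC; congr (_ + _).
    rewrite [RHS](reindex (@enum_val J predT)) /=; last first.
      by apply: onW_bij; exact: enum_val_bij.
    by apply: eq_bigr => i _; rewrite col_mxEd mxE.
  by apply: eq_bigr => i _; rewrite col_mxEu mxE.
- move=> z; pose y : 'cV[C]_#|K| := \col_k z (enum_val k).
  exists (fun j => (V *m y) (rshift p (enum_rank j)) 0).
  exists (fun i => (V *m y) (lshift _ i) 0) => k; rewrite fE.
  have -> : vec (fun j => (V *m y) (rshift p (enum_rank j)) 0)
                (fun i => (V *m y) (lshift _ i) 0) = V *m y.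
    rewrite /vec -[RHS]vsubmxK; congr col_mx; apply/colP => i; rewrite !mxE//.
    by rewrite enum_valK.
  by rewrite mulmxA hV' mul1mx mxE enum_rankK.
Qed.

End Unitary.

(** * Tail of a linear form whose coefficients vary with the base point *)

Section Tail.
Context {R : realType}.
Local Notation C := R[i].

(** Coordinates in which a given unit linear form is the last one: the case of a single form in
    [isometry_extension]. *)
Lemma functional_isometry (K : finType) (v : K -> C) : \sum_k cn2 (v k) = 1 ->
  exists phi : cspace R 'I_#|K|.-1 * cspace R unit -> cspace R K,
    [/\ measurable_fun setT phi,
        forall x y, phi (eadd (prod_euclid (ceuclid _) (ceuclid _)) x y) =
                    eadd (ceuclid K) (phi x) (phi y),
        forall y, exists x, phi x = y,
        forall x, enrm (ceuclid K) (phi x) =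
                  enrm (prod_euclid (ceuclid _) (ceuclid _)) x
      & forall x, \sum_k v k * dec (phi x) k = dec x.2 tt].
Proof.
move=> hv.
have [j j'|p [W [e1]]] := @isometry_extension R unit K (fun _ => v).
  rewrite (eq_bigr (fun k => (cn2 (v k))%:C%C)); last by move=> k _; rewrite mul_conjc.
  by rewrite -rmorph_sum/= hv; case: j j' => -[].
have ep : p = #|K|.-1 by rewrite -e1 card_unit addn1.
subst p; set f := (fun a e k => _) => -[fL fN fS].
pose phi (x : cspace R 'I_#|K|.-1 * cspace R unit) : cspace R K :=
  enc (f (dec x.2) (dec x.1)).
have phiE x k : dec (phi x) k = f (dec x.2) (dec x.1) k by rewrite encK.
exists phi; split.
- apply: measurable_enc => k; apply: cmeasD.
    apply: cmeas_sum => i; apply: cmeasM; last exact: cmeas_cst.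
    exact: (cmeas_comp (cmeas_dec i) measurable_snd).
  apply: cmeas_sum => i; apply: cmeasM; last exact: cmeas_cst.
  exact: (cmeas_comp (cmeas_dec i) measurable_fst).
- move=> x y; apply: dec_inj => k; rewrite dec_add !phiE /f /= addrACA.
  congr (_ + _); rewrite -big_split /=; apply: eq_bigr => i _;
    by rewrite dec_add mulrDl.
- move=> y; have [a [e h]] := fS (dec y).
  exists (enc e, enc a); apply: dec_inj => k; rewrite phiE -h /f /=.
  by congr (_ + _); apply: eq_bigr => i _; rewrite encK.
- move=> x; rewrite enrm_cspace; under eq_bigr do rewrite phiE.
  by rewrite fN /= !enrm_cspace addrC.
- by move=> x; under eq_bigr do rewrite phiE; rewrite (fL _ _ tt).
Qed.

Context d (T : measurableType d) (X : euclid R T) (q : nat) (K : finType).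
Variable v : T -> K -> C.
Hypothesis dimX : edim X = (q * 2)%N.
Hypothesis K_gt0 : (0 < #|K|)%N.
Hypothesis dim_gt0 : (0 < q + #|K|.-1)%N.
Hypothesis mv : forall k, cmeas (fun x => v x k).
Let N x := \sum_k cn2 (v x k).
Hypothesis N_null : evol X [set x | N x = 0] = 0%E.

Let Y : euclid R _ := ceuclid K.
Let A : euclid R (cspace R 'I_#|K|.-1) := ceuclid _.
Let W : euclid R (cspace R unit) := ceuclid unit.
Let AW := prod_euclid A W.
Let P := prod_euclid X Y.
Let Q := prod_euclid X AW.
Let Q' := prod_euclid (prod_euclid X A) W.
Let c := rvol Y / rvol AW.

Lemma measurable_sqnorm : measurable_fun setT N.
Proof.
have -> : N = (fun x => \sum_(k <- index_enum K) cn2 (v x k)) by [].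
elim: (index_enum K) => [|k r IH].
  by under eq_fun do rewrite big_nil; exact: measurable_cst.
under eq_fun do rewrite big_cons.
by apply: measurable_funD => //; exact: measurable_cn2.
Qed.

Let mN0 : measurable [set x | N x = 0].
Proof.
rewrite (_ : mkset _ = [set x | N x <= 0]).
  by apply: measurable_le_fun; [exact: measurable_sqnorm|exact: measurable_cst].
apply/seteqP; split=> x /= h; first by rewrite h.
by apply/eqP; rewrite eq_le h sumr_ge0// => k _; exact: cn2_ge0.
Qed.

Let mform : cmeas (fun p : T * cspace R K => \sum_k v p.1 k * dec p.2 k).
Proof.
apply: cmeas_sum => k; apply: cmeasM.
  exact: (cmeas_comp (mv k) measurable_fst).
exact: (cmeas_comp (cmeas_dec k) measurable_snd).
Qed.

Lemma evol_isometryE d1 d2 (T1 : measurableType d1) (T2 : measurableType d2)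
    (X1 : euclid R T1) (X2 : euclid R T2) (f : T1 -> T2) (S : set T2) :
  measurable_fun setT f ->
  (forall x y, f (eadd X1 x y) = eadd X2 (f x) (f y)) ->
  (forall y, exists x, f x = y) ->
  (forall x, enrm X2 (f x) = enrm X1 x) ->
  measurable S ->
  evol X2 S = ((rvol X2 / rvol X1)%:E * evol X1 [set x | S (f x)])%E.
Proof.
move=> mf fa fs fn mS; have := evol_isometry mf fa fs fn mS.
have r1 := rvol_gt0 X1.
rewrite mulrC EFinM -muleA [((rvol X2)%:E * _)%E]muleC => ->.
by rewrite muleCA -EFinM mulVf ?gt_eqF// mule1.
Qed.

(** The sections of the two balls correspond under an isometry of the fibres, so the volumes differ
    by the ratio [c] of the fibre balls. Any unit form provides such an isometry; a coordinate form
    is taken. *)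
Lemma rvol_slices : rvol P = c * rvol Q.
Proof.
apply: EFin_inj; rewrite EFinM -!rvolE.
change ((evol X \x evol Y) (ball1 P) = c%:E * (evol X \x evol AW) (ball1 Q))%E.
have mQ : measurable (ball1 Q) := measurable_ball1 Q.
rewrite /product_measure1 -ge0_integralZl//; last 2 first.
- exact: measurable_fun_xsection.
- by rewrite lee_fin divr_ge0// ltW// rvol_gt0.
apply: eq_integral => x _ /=; rewrite !xsectionE.
have k0 : K by have /card_gt0P/sigW[k _] := K_gt0.
have hk0 : \sum_k cn2 ((k == k0)%:R : C) = 1.
  rewrite (bigD1 k0)//= eqxx cn21 big1 ?addr0// => k /negPf ->.
  by rewrite cn20.
have [phi [mphi phiD phiS phiN _]] := functional_isometry hk0.
rewrite (evol_isometryE mphi phiD phiS phiN).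
  congr (_ * evol AW _)%E; apply/seteqP; split=> y;
  by rewrite /ball1 /= phiN.
exact: (measurable_preim (pair1_measurable x) (measurable_ball1 P)).
Qed.

(** For fixed x an isometry of the fibre makes the unit form v x / |v x| the last coordinate; the
    set then no longer depends on v, and [evol_disc_tail] applies with the #|K| - 1 other
    coordinates joined to those of X. The isometry is chosen for each x separately: only volumes of
    sections are compared, so no measurable choice is involved. *)
Lemma evol_functional_tail (tau : R) : 0 <= tau <= 1 ->
  evol P [set p | [/\ N p.1 <> 0, enrm P p <= 1 &
    cn2 (\sum_k v p.1 k * dec p.2 k) <= tau * (N p.1 * enrm P p)]] =
  ((1 - (1 - tau) ^+ (q + #|K|.-1)) * rvol P)%:E.
Proof.
move=> t01; set S := [set p | _].
have mS : measurable S.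
  rewrite (_ : S = [set p | ~ (N p.1 = 0)] `&` (ball1 P `&`
    [set p | cn2 (\sum_k v p.1 k * dec p.2 k) <= tau * (N p.1 * enrm P p)])).
    apply: measurableI.
      exact: (measurable_preim measurable_fst (measurableC mN0)).
    apply: measurableI; first exact: measurable_ball1.
    apply: measurable_le_fun; first exact: measurable_cn2.
    apply: measurable_funM; first exact: measurable_cst.
    apply: measurable_funM; last exact: enrm_meas.
    exact: (measurableT_comp measurable_sqnorm measurable_fst).
  by apply/seteqP; split=> p /=; [case=> ? ? ?|case=> ? [? ?]]; split.
pose S' := [set p | enrm Q' p <= 1 /\ enrm W p.2 <= tau * enrm Q' p].
have mS' : measurable S'.
  apply: measurableI; first exact: (measurable_ball1 Q').
  apply: measurable_le_fun; first exact: measurable_enrm.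
  by apply: measurable_funM; [exact: measurable_cst|exact: measurable_enrm].
have volS' : evol Q' S' = ((1 - (1 - tau) ^+ (q + #|K|.-1)) * rvol Q')%:E.
  apply: evol_disc_tail => //.
  by rewrite /= dimX edim_cspace card_ord mulnDl.
pose g (p : T * (cspace R 'I_#|K|.-1 * cspace R unit)) := ((p.1, p.2.1), p.2.2).
have mg : measurable_fun setT g.
  by apply: measurable_fun_pair; [apply: measurable_fun_pair|];
    (try apply: measurableT_comp).
have volQ : evol Q [set p | S' (g p)] =
    ((1 - (1 - tau) ^+ (q + #|K|.-1)) * rvol Q)%:E.
  pose h (p : (T * cspace R 'I_#|K|.-1) * cspace R unit) := (p.1.1, (p.1.2, p.2)).
  have mh : measurable_fun setT h.
    by apply: measurable_fun_pair; [|apply: measurable_fun_pair];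
      (try apply: measurableT_comp).
  apply: (@evol_isometry_ratio _ _ _ _ _ Q' Q h) => //.
  - by move=> [x [y w]]; exists ((x, y), w).
  - by move=> [[x y] w]; rewrite /= addrA.
  - exact: measurable_preim.
rewrite rvol_slices mulrCA EFinM -volQ.
change ((evol X \x evol Y) S = c%:E * (evol X \x evol AW) [set p | S' (g p)])%E.
have mgS : measurable [set p | S' (g p)] by exact: measurable_preim.
rewrite /product_measure1 -ge0_integralZl//; last 2 first.
- exact: measurable_fun_xsection.
- by rewrite lee_fin divr_ge0// ltW// rvol_gt0.
apply: ge0_ae_eq_integral => //.
- exact: measurable_fun_xsection.
- by apply: measurable_funeM; exact: measurable_fun_xsection.
- by move=> x _; rewrite mule_ge0// lee_fin divr_ge0// ltW// rvol_gt0.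
(* The sections agree off the null set where the form vanishes and has no direction. *)
exists [set x | N x = 0]; split => //= x /=.
apply: contra_notP => Nx _ /=; rewrite !xsectionE.
have N0 : 0 < N x.
  rewrite lt_neqAle eq_sym (introN eqP Nx)/=.
  by apply: sumr_ge0 => k _; exact: cn2_ge0.
pose s := (Num.sqrt (N x))^-1.
have s2 : s ^+ 2 = (N x)^-1 by rewrite exprVn sqr_sqrtr// ltW.
have hs : \sum_k cn2 (s%:C%C * v x k) = 1.
  under eq_bigr do rewrite cn2M cn2_real s2.
  by rewrite -mulr_sumr mulVf// gt_eqF.
have [phi [mphi phiD phiS phiN phiv]] := functional_isometry hs.
rewrite (evol_isometryE mphi phiD phiS phiN); last first.
  exact: (measurable_preim (pair1_measurable x) mS).
have e1 y : enrm W y.2 = cn2 (dec y.2 tt).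
  by rewrite enrm_cspace (bigD1 tt)//= big1 ?addr0// => -[].
have e2 y : cn2 (\sum_k v x k * dec (phi y) k) = N x * enrm W y.2.
  rewrite e1 -phiv; under [in RHS]eq_bigr do rewrite -mulrA.
  by rewrite -mulr_sumr cn2M cn2_real s2 mulrA divff ?mul1r// gt_eqF.
congr (_ * evol AW _)%E; apply/seteqP; split=> y;
  rewrite /S /S' /g /= e2 mulrCA ler_pM2l// phiN /= addrA.
  by case.
by case.
Qed.

End Tail.

(** * Moments of the Beta law *)

Section Moments.
Context {R : realType}.
Notation mu := (@lebesgue_measure R).
Local Open Scope ereal_scope.

Lemma integral_deriv_poly (p : {poly R}) (a b : R) : (a <= b)%R ->
  \int[mu]_(x in `[a, b]) ((p^`()).[x])%:E = (p.[b] - p.[a])%:E.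
Proof.
rewrite le_eqVlt => /predU1P[->|ab].
  by rewrite set_itv1 integral_set1 subrr.
rewrite (@continuous_FTC2 _ _ (fun x => p.[x]) _ _ ab) ?EFinB//.
- by apply: continuous_subspaceT => x; exact: continuous_horner.
- split=> [x _| |]; first exact: derivable_horner.
    by apply: cvg_at_right_filter; exact: continuous_horner.
  by apply: cvg_at_left_filter; exact: continuous_horner.
- by move=> x _; rewrite derivE.
Qed.

Lemma integral_beta_density (a : R) (j : nat) : (0 < j)%N -> (a <= 1)%R ->
  \int[mu]_(r in `[a, 1%R]) (j%:R * (1 - r) ^+ j.-1)%:E = ((1 - a) ^+ j)%:E.
Proof.
move=> j0 a1; pose p : {poly R} := (- (1%:P - 'X) ^+ j)%R.
transitivity (\int[mu]_(x in `[a, 1%R]) ((p^`()).[x])%:E).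
  apply: eq_integral => x _; congr EFin.
  rewrite /p derivN deriv_exp derivB derivX derivC hornerN hornerMn !hornerE.
  by rewrite mulr_natl; ring.
by rewrite integral_deriv_poly// /p !hornerE subrr expr0n gtn_eqF//= oppr0 sub0r opprK.
Qed.

(** Expanding gives two Beta integrals, 1 and j / (M + j); [p] is an antiderivative of the
    integrand. *)
Lemma integral_beta_tail (j M : nat) : (0 < j)%N ->
  \int[mu]_(r in `[0%R, 1%R]) (j%:R * (1 - r) ^+ j.-1 * (1 - (1 - r) ^+ M))%:E =
  (M%:R / (M + j)%:R)%:E.
Proof.
move=> j0; have Mj0 : (M + j)%:R != 0%R :> R by rewrite pnatr_eq0; lia.
pose p : {poly R} := (- (1%:P - 'X) ^+ j + (j%:R / (M + j)%:R) *: (1%:P - 'X) ^+ (M + j))%R.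
transitivity (\int[mu]_(x in `[0%R, 1%R]) ((p^`()).[x])%:E).
  apply: eq_integral => x _; congr EFin.
  rewrite /p derivD derivN derivZ !deriv_exp derivB derivX derivC !(hornerE, hornerMn).
  have -> : (M + j).-1 = (M + j.-1)%N by lia.
  rewrite exprD -(mulr_natl (-1 * (1 - x) ^+ j.-1)%R).
  rewrite -(mulr_natl (-1 * ((1 - x) ^+ M * (1 - x) ^+ j.-1))%R).
  move: ((M + j)%:R : R)%R Mj0 ((1 - x) ^+ j.-1)%R ((1 - x) ^+ M)%R => q q0 a b.
  by move: (j%:R : R)%R => c; rewrite (mulrA (c / q)%R) divfK//; ring.
rewrite integral_deriv_poly// /p !hornerE subrr !expr0n gtn_eqF//.
rewrite gtn_eqF ?addn_gt0 ?j0 ?orbT// !subr0 !expr1n; congr EFin.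
rewrite !mulr0n oppr0 mulr0; move: Mj0; rewrite natrD.
by move: (M%:R : R)%R (j%:R : R)%R => a b ab; field.
Qed.

(** A layer-cake formula: (1 - z)^j is the integral of j (1 - r)^(j - 1) over r in [z, 1], and
    Tonelli turns the moment into an integral of the given distribution function. *)
Lemma integral_tail_power d (T : measurableType d)
    (nu : {sigma_finite_measure set T -> \bar R}) (B : set T) (z : T -> R) (V : R)
    (j M : nat) :
  (0 < j)%N -> measurable B -> measurable_fun setT z ->
  (forall x, B x -> (0 <= z x <= 1)%R) -> (0 <= V)%R ->
  (forall r, (0 <= r <= 1)%R ->
    nu (B `&` [set x | (z x <= r)%R]) = ((1 - (1 - r) ^+ M) * V)%:E) ->
  \int[nu]_(x in B) ((1 - z x) ^+ j)%:E = (M%:R / (M + j)%:R * V)%:E.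
Proof.
move=> j0 mB mz z01 V0 tail.
pose S : set (T * measurableTypeR R) :=
  [set p | B p.1 /\ (z p.1 <= p.2)%R /\ (0 <= p.2)%R /\ (p.2 <= 1)%R].
have m2 : measurable_fun setT (fun p : T * measurableTypeR R => p.2 : R).
  exact: (@measurable_snd _ _ T (measurableTypeR R)).
have mS : measurable S.
  apply: measurableI; first exact: measurable_preim.
  apply: measurableI.
    by apply: measurable_le_fun => //; exact: measurableT_comp.
  by apply: measurableI; apply: measurable_le_fun => //; exact: measurable_cst.
(* The absolute value makes the weight nonnegative on the whole line, as Tonelli requires; on [0, 1]
   it changes nothing. *)
pose w (r : R) : R := (j%:R * `|1 - r| ^+ j.-1)%R.
have w0 r : (0 <= w r)%R by rewrite mulr_ge0 ?exprn_ge0.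
pose f p := (w p.2 * \1_S p)%:E : \bar R.
have mw : measurable_fun setT w.
  apply: measurable_funM; first exact: measurable_cst.
  apply: measurable_funX; apply: measurableT_comp => //.
  by apply: measurable_funB => //; exact: measurable_cst.
have mf : measurable_fun setT f.
  apply/measurable_EFinP; apply: measurable_funM; last exact: measurable_indic.
  exact: (measurableT_comp mw m2).
have f0 p : 0 <= f p by rewrite lee_fin mulr_ge0.
have := @fubini_tonelli _ _ T (measurableTypeR R) R nu mu f mf f0.
have -> : \int[nu]_x \int[mu]_y f (x, y) = \int[nu]_(x in B) ((1 - z x) ^+ j)%:E.
  rewrite [RHS]integral_mkcond; apply: eq_integral => x _; rewrite patchE.
  case: ifPn => [/set_mem Bx|/negP nBx]; last first.
    apply: integral0_eq => y _; rewrite /f indicE memNset ?mulr0// => -[Bx _].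
    exact/nBx/mem_set.
  have /andP[z0 z1] := z01 x Bx.
  rewrite -integral_beta_density// [RHS]integral_mkcond.
  apply: eq_integral => y _; rewrite patchE /f indicE /=.
  case: ifPn => [|/negP ny].
    rewrite inE /= in_itv /= => /andP[h1 h2].
    rewrite mem_set ?mulr1 /w ?ger0_norm ?subr_ge0//.
    by split=> //; split=> //; split=> //; exact: le_trans z0 h1.
  rewrite memNset ?mulr0// => -[_ /= [h1 [h2 h3]]]; apply: ny.
  by rewrite inE /= in_itv /= h1.
move=> ->.
transitivity (\int[mu]_(r in `[0%R, 1%R])
    (V%:E * (j%:R * (1 - r) ^+ j.-1 * (1 - (1 - r) ^+ M))%:E)).
  rewrite [RHS]integral_mkcond; apply: eq_integral => r _; rewrite patchE.
  case: ifPn => [|/negP nr].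
    rewrite inE /= in_itv /= => /andP[r0 r1].
    transitivity (\int[nu]_x ((w r)%:E * (\1_(B `&` [set x | (z x <= r)%R]) x)%:E)).
      apply: eq_integral => x _; rewrite /f -EFinM !indicE; congr ((_ * _%:R)%:E).
      congr nat_of_bool; apply/idP/idP; rewrite !inE.
        by move=> [? [? _]]; split.
      by move=> [? ?]; do 3 split => //.
    rewrite ge0_integralZl//; last by rewrite lee_fin.
    + rewrite integral_indic ?setIT//; last first.
        by apply: measurableI => //; apply: measurable_le_fun => //; exact: measurable_cst.
      rewrite [X in _ * X]tail ?r0// -!EFinM /w ger0_norm ?subr_ge0//.
      by congr EFin; ring.
    + apply/measurable_EFinP; apply: measurable_indic.
      by apply: measurableI => //; apply: measurable_le_fun => //; exact: measurable_cst.
  apply: integral0_eq => x _; rewrite /f indicE memNset ?mulr0// => -[_ /= [_ [h1 h2]]].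
  by apply: nr; rewrite inE /= in_itv /= h1.
rewrite ge0_integralZl//.
- by rewrite integral_beta_tail// -EFinM mulrC.
- apply/measurable_EFinP; apply: measurable_funTS.
  apply: measurable_funM; first apply: measurable_funM.
  + exact: measurable_cst.
  + by apply: measurable_funX; apply: measurable_funB => //; exact: measurable_cst.
  + apply: measurable_funB; first exact: measurable_cst.
    by apply: measurable_funX; apply: measurable_funB => //; exact: measurable_cst.
- move=> r; rewrite /= in_itv /= => /andP[r0 r1]; rewrite lee_fin mulr_ge0//.
    by rewrite mulr_ge0// exprn_ge0// subr_ge0.
  by rewrite subr_ge0 exprn_ile1//; lra.
Qed.

End Moments.

(** * Singular matrices have volume zero *)

Section NullSets.
Context {R : realType}.
Local Notation C := R[i].

(** Tonelli on the pairs (x, t) with w t + x in D: the sections in t are null, while each section in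
    x is a translate of D. So the volume of D times the infinite length of the line is 0. *)
Lemma evol_null_lines d (T : measurableType d) (X : euclid R T)
    (w : measurableTypeR R -> T) (D : set T) :
  measurable_fun setT w -> measurable D ->
  (forall x, lebesgue_measure ([set t | D (eadd X (w t) x)] : set R) = 0%E) ->
  evol X D = 0%E.
Proof.
move=> mw mD D0.
pose S : set (T * measurableTypeR R) := [set p | D (eadd X (w p.2) p.1)].
have mS : measurable S.
  apply: (measurable_preim _ mD); apply: measurable_eadd => //.
  exact: (measurableT_comp mw (@measurable_snd _ _ T (measurableTypeR R))).
have := indic_fubini_tonelli (evol X) (@lebesgue_measure R) mS.
rewrite indic_fubini_tonelli_FE// indic_fubini_tonelli_GE//.
rewrite integral0_eq; last by move=> x _; rewrite /= xsectionE; exact: D0.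
rewrite (eq_integral (fun=> evol X D)); last first.
  move=> t _ /=; rewrite ysectionE.
  exact: (evol_add X (w t) mD).
rewrite integral_cst// => /esym/eqP; rewrite mule_eq0 => /orP[/eqP//|].
have := @lebesgue_measure_itv R `]-oo, +oo[; rewrite set_itvNyy /= => ->.
by [].
Qed.

(** A vanishing determinant makes -t a root of the characteristic polynomial of [M], so that t lies
    in a finite set. *)
Lemma det_line_null k (M : 'M[C]_k) :
  lebesgue_measure ([set t : R | \det (t%:C%C%:M + M) = 0] : set R) = 0%E.
Proof.
have [rs rsE] := closed_field_poly_normal (char_poly M).
apply: countable_lebesgue_measure0; apply: finite_set_countable.
apply: (@sub_finite_set _ _ [set` [seq - complex.Re z | z <- rs]]) => [t /= ht|].
  2: exact: finite_seq.
have h0 : root (char_poly M) (- t%:C%C).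
  rewrite /root /char_poly -horner_evalE -det_map_mx /=.
  rewrite (_ : map_mx _ _ = - (t%:C%C%:M + M)).
    by rewrite -scaleN1r detZ ht mulr0.
  apply/matrixP => i j; rewrite !mxE horner_evalE hornerD hornerN hornerC.
  by rewrite hornerMn hornerX opprD mulNrn.
apply/mapP; exists (- t%:C%C); last by rewrite /= opprK.
move: h0; rewrite rsE rootZ ?root_prod_XsubC//.
by rewrite lead_coef_eq0 monic_neq0// char_poly_monic.
Qed.

Definition dmx p q (t : cspace R ('I_p * 'I_q)%type) : 'M[C]_(p, q) :=
  \matrix_(i, j) dec t (i, j).

Lemma dmx_add p q t t' :
  @dmx p q (eadd (ceuclid _) t t') = dmx t + dmx t'.
Proof. by apply/matrixP => i j; rewrite !mxE dec_add. Qed.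

Lemma measurable_eq0_cn2 d (T : measurableType d) (f : T -> C) :
  cmeas f -> measurable [set x | f x = 0].
Proof.
move=> mf; rewrite (_ : mkset _ = [set x | cn2 (f x) <= 0]).
  apply: measurable_le_fun; [exact: measurable_cn2|exact: measurable_cst].
apply/seteqP; split=> x /= h; first by rewrite h cn20.
by apply/eqP; rewrite -cn2_eq0 eq_le h cn2_ge0.
Qed.

Lemma cmeas_dmx p q i j : cmeas (fun t => @dmx p q t i j).
Proof. by under [X in cmeas X]eq_fun do rewrite mxE; exact: cmeas_dec. Qed.

Lemma evol_singular_null k l :
  evol (ceuclid _) [set t | \det (usubmx (@dmx (k + l) k t)) = 0] = 0%E.
Proof.
(* The line that moves the top square block by real multiples of the identity. *)
pose w (t : measurableTypeR R) : cspace R ('I_(k + l) * 'I_k)%type :=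
  enc (fun p => ((p.1 == lshift l p.2)%:R * (t%:C%C))).
apply: (@evol_null_lines _ _ _ w).
- apply: measurable_enc => p; split => /=; last first.
    apply: (eq_measurable_fun (fun _ : measurableTypeR R => 0 : R)); last exact: measurable_cst.
    by move=> t _; case: (_ == _); rewrite /= ?mul1r ?mul0r ?mulr0 ?addr0.
  apply: (eq_measurable_fun (fun t : measurableTypeR R => (p.1 == lshift l p.2)%:R * t : R)).
    by move=> t _; case: (_ == _); rewrite /= ?mul1r ?mul0r ?subr0.
  by apply: measurable_funM; [exact: measurable_cst|exact: measurable_id].
- apply: measurable_eq0_cn2; apply: cmeas_det => i j.
  by under [X in cmeas X]eq_fun do rewrite mxE; exact: cmeas_dmx.
- move=> x; rewrite -[RHS](det_line_null (usubmx (dmx x))).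
  congr (lebesgue_measure _); apply/seteqP; split=> t;
    rewrite /= dmx_add raddfD /= (_ : usubmx (dmx (w t)) = t%:C%C%:M)//;
    apply/matrixP => i j; rewrite !mxE encK /= (inj_eq (@lshift_inj _ _));
    by case: (i == j); rewrite ?mul1r ?mul0r.
Qed.

End NullSets.

(** * Tail of a fixed linear form *)

Section PlainTail.
Context {R : realType} (K : finType) (v : K -> R[i]).
Let Y := @ceuclid R K.
Let N := \sum_k cn2 (v k).
Hypothesis N0 : N != 0.
Hypothesis K1 : (1 < #|K|)%N.

(** The case of [evol_functional_tail] in which the base is a single point, the space of empty
    tuples. *)
Lemma evol_linear_tail (tau : R) : 0 <= tau <= 1 ->
  evol Y [set t | enrm Y t <= 1 /\
    cn2 (\sum_k v k * dec t k) <= tau * (N * enrm Y t)] =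
  ((1 - (1 - tau) ^+ #|K|.-1) * rvol Y)%:E.
Proof.
move=> t01; pose O := @tuple_euclid R 0.
have := @evol_functional_tail R _ _ O 0 K (fun=> v) erefl.
have K0 : (0 < #|K|.-1)%N by rewrite -ltnS prednK// (ltn_trans _ K1).
move=> /(_ (ltnW K1) K0 (fun k => @cmeas_cst _ _ _ (v k)) _ tau t01); rewrite add0n => H.
apply: (@evol_isometry_ratio _ _ _ _ _ (prod_euclid O Y) Y snd) => //.
- by move=> y; exists ([tuple], y).
- by move=> [x y] /=; rewrite add0r.
- apply: measurableI; first exact: measurable_ball1.
  apply: measurable_le_fun.
    apply: measurable_cn2; apply: cmeas_sum => k.
    by apply: cmeasM; [exact: cmeas_cst|exact: cmeas_dec].
  by do 2 (apply: measurable_funM; first exact: measurable_cst); exact: enrm_meas.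
- rewrite -H.
    congr (evol _ _); apply/seteqP; split=> -[x y] /=; rewrite add0r.
      by move=> [? ?]; split=> //; apply/eqP.
    by case.
  rewrite (_ : mkset _ = set0) ?measure0//.
  by apply/seteqP; split=> x //= /eqP; rewrite (negPf N0).
Qed.

(** The origin lies in the set of [evol_linear_tail] at tau = 0, which has volume 0. *)
Lemma evol_origin : evol Y [set t | enrm Y t <= 0] = 0%E.
Proof.
apply/eqP; rewrite eq_le measure_ge0 andbT.
have := @evol_linear_tail 0; rewrite lexx ler01 => /(_ isT).
rewrite subr0 expr1n subrr mul0r => H; rewrite -[X in (_ <= X)%E]H.
apply: le_measure; rewrite ?inE.
- by apply: measurable_le_fun; [exact: enrm_meas|exact: measurable_cst].
- apply: measurableI; first exact: measurable_ball1.
  apply: measurable_le_fun.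
    apply: measurable_cn2; apply: cmeas_sum => k.
    by apply: cmeasM; [exact: cmeas_cst|exact: cmeas_dec].
  by do 2 (apply: measurable_funM; first exact: measurable_cst); exact: enrm_meas.
- move=> t /= h; split; first by rewrite (le_trans h).
  have e0 k : dec t k = 0.
    apply/eqP; rewrite -cn2_eq0 eq_le cn2_ge0 andbT (le_trans _ h)//.
    rewrite enrm_cspace (bigD1 k)//= lerDl sumr_ge0// => i _; exact: cn2_ge0.
  rewrite big1; first by rewrite cn20 mul0r.
  by move=> k _; rewrite e0 mulr0.
Qed.

End PlainTail.

(** * The bordered determinant *)

Section ProductNull.
Context {R : realType} d1 d2 (T1 : measurableType d1) (T2 : measurableType d2).
Variables (X : euclid R T1) (Y : euclid R T2).
Local Open Scope ereal_scope.

Lemma prod_evol_swap (A : set (T1 * T2)) : measurable A ->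
  evol (prod_euclid X Y) A = \int[evol Y]_y evol X (ysection A y).
Proof.
move=> mA; change ((evol X \x evol Y) A = (evol X \x^ evol Y) A).
rewrite /product_measure1 /product_measure2.
have := indic_fubini_tonelli (evol X) (evol Y) mA.
by rewrite indic_fubini_tonelli_FE// indic_fubini_tonelli_GE.
Qed.

Lemma prod_null_fst A : measurable A -> evol X A = 0 ->
  evol (prod_euclid X Y) [set p | A p.1] = 0.
Proof.
move=> mA A0; rewrite prod_evol_swap; last exact: measurable_preim.
by apply: integral0_eq => y _; rewrite ysectionE.
Qed.

Lemma prod_null_snd A : measurable A -> evol Y A = 0 ->
  evol (prod_euclid X Y) [set p | A p.2] = 0.
Proof.
move=> mA A0; change ((evol X \x evol Y) [set p | A p.2] = 0).
by apply: integral0_eq => x _; rewrite /= xsectionE.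
Qed.

End ProductNull.

Section Border.
Context {R : realType} {k : nat}.
Local Notation C := R[i].
Implicit Types (F : 'M[C]_(k + 1, k)) (g u : 'cV[C]_(k + 1)).

Definition bdet F g : C := \det (row_mx F g).

Definition elast : 'cV[C]_(k + 1) := delta_mx (rshift k ord0) 0.

(** Laplace expansion along the last column, whose cofactors depend on F alone; the numbers
    [bdet F (delta_mx i 0)] are these cofactors. *)
Lemma bdet_sum F g : bdet F g = \sum_i bdet F (delta_mx i 0) * g i 0.
Proof.
have cofE h i : cofactor (row_mx F h) i (rshift k ord0) =
                cofactor (row_mx F 0) i (rshift k ord0).
  rewrite /cofactor; congr (_ * \det _); apply/matrixP => a b.
  rewrite !mxE; case: splitP => // j /= hj.
  have := ltn_ord b; rewrite /bump in hj; have := ltn_ord j; lia.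
have bE h : bdet F h = \sum_i h i 0 * cofactor (row_mx F 0) i (rshift k ord0).
  rewrite /bdet (expand_det_col _ (rshift k ord0)); apply: eq_bigr => i _.
  by rewrite cofE row_mxEr.
rewrite bE; apply: eq_bigr => i _; rewrite bE mulrC; congr (_ * _).
rewrite (bigD1 i)//= mxE !eqxx mul1r big1 ?addr0// => j /negPf ji.
by rewrite mxE ji mul0r.
Qed.

Lemma bdetZ F a u : bdet F (a *: u) = a * bdet F u.
Proof.
rewrite bdet_sum [in RHS]bdet_sum mulr_sumr; apply: eq_bigr => i _.
by rewrite mxE mulrCA.
Qed.

Lemma bdet_mull (U : 'M[C]_(k + 1)) F u :
  bdet (U *m F) (U *m u) = \det U * bdet F u.
Proof. by rewrite /bdet -mul_mx_row det_mulmx. Qed.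

(** The corner determinant is thus itself a bordered determinant, so that a unitary matrix acts on
    numerator and denominator alike. *)
Lemma bdet_last F : bdet F elast = \det (usubmx F).
Proof.
rewrite /bdet -{1}[F]vsubmxK (_ : elast = col_mx 0 1%:M).
  by rewrite -block_mxEh det_lblock det1 mulr1.
apply/colP => i; rewrite !mxE; case: splitP => j ij; rewrite !mxE.
  by case: eqP => // ei; have := ltn_ord j; move: ij; rewrite ei /=; lia.
by rewrite !ord1 eqxx andbT -val_eqE /= ij !ord1 /= eqxx.
Qed.

Definition vnorm2 u : R := \sum_i cn2 (u i 0).

(** The adjoint of u / |u| is completed to a unitary matrix V having it as last row; V sends u / |u|
    to the last basis vector, and U is the adjoint of V. *)
Lemma unitary_last (u : 'cV[C]_(k + 1)) : u != 0 ->
  exists U : 'M[C]_(k + 1), ctmx U *m U = 1%:M /\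
    u = (Num.sqrt (vnorm2 u))%:C%C *: (U *m elast).
Proof.
move=> u0; pose a := Num.sqrt (vnorm2 u).
have n0 : 0 < vnorm2 u.
  rewrite lt_neqAle sumr_ge0 ?andbT; last by move=> *; exact: cn2_ge0.
  rewrite eq_sym; apply: contra u0 => /eqP h; apply/eqP/colP => i; rewrite mxE.
  apply/eqP; rewrite -cn2_eq0; apply/eqP.
  exact: (psumr_eq0P (fun j _ => cn2_ge0 (u j 0)) h).
have a0 : a%:C%C != 0 by rewrite (inj_eq (@complexI R)) gt_eqF// sqrtr_gt0.
pose w := (a%:C%C)^-1 *: u.
have hw : ctmx w *m w = 1%:M.
  apply/matrixP => i j; rewrite !ord1 !mxE eqxx.
  rewrite (eq_bigr (fun i => ((vnorm2 u)^-1 * cn2 (u i 0))%:C%C)); last first.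
    move=> l _; rewrite !mxE mulrC mul_conjc cn2M.
    by rewrite -fmorphV cn2_real exprVn sqr_sqrtr// ltW.
  by rewrite -rmorph_sum -mulr_sumr /= mulVf// gt_eqF.
have [|p [W [e1 hV]]] := @unitary_completion R 1 (k + 1) (ctmx w).
  by rewrite ctmxK.
have e2 : p = k by apply: (@addIn 1).
subst p; pose V := col_mx W (ctmx w).
have hV' : ctmx V *m V = 1%:M by apply: mulmx1C.
exists (ctmx V); split; first by rewrite ctmxK.
have Vw : V *m w = elast.
  have : V *m ctmx V = 1%:M by [].
  rewrite {2}/V /ctmx map_col_mx tr_col_mx -/(ctmx W) -/(ctmx (ctmx w)) ctmxK.
  rewrite mul_mx_row => /(congr1 rsubmx); rewrite row_mxKr => ->.
  apply/colP => i; rewrite !mxE -[in RHS]val_eqE -[in LHS]val_eqE /=.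
  by rewrite eqxx andbT.
by rewrite -Vw mulmxA hV' mul1mx /w scalerA divff// scale1r.
Qed.

End Border.

Lemma sum_pair (V : nmodType) (I J : finType) (f : I * J -> V) :
  \sum_i f i = \sum_i \sum_j f (i, j).
Proof. by rewrite pair_bigA; apply: eq_bigr => -[]. Qed.

(** * Unitary action on spaces of matrices *)

Section UnitaryAction.
Context {R : realType}.
Local Notation C := R[i].

Lemma sum_cn2_unitary a b (U : 'M[C]_a) (M : 'M[C]_(a, b)) :
  ctmx U *m U = 1%:M ->
  \sum_i \sum_j cn2 ((U *m M) i j) = \sum_i \sum_j cn2 (M i j).
Proof.
move=> hU.
have tr (B : 'M[C]_(a, b)) : \tr (ctmx B *m B) = (\sum_i \sum_j cn2 (B i j))%:C%C.
  rewrite exchange_big rmorph_sum; apply: eq_bigr => j _.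
  rewrite mxE rmorph_sum; apply: eq_bigr => i _.
  by rewrite !mxE mulrC mul_conjc.
apply: complexI; rewrite -!tr ctmxM mulmxA -(mulmxA (ctmx M)) hU mulmx1 //.
Qed.

Definition umul a b (U : 'M[C]_a) (t : cspace R ('I_a * 'I_b)%type) :
    cspace R ('I_a * 'I_b)%type :=
  enc (fun i => (U *m dmx t) i.1 i.2).

Lemma dmx_umul a b (U : 'M[C]_a) t : dmx (@umul a b U t) = U *m dmx t.
Proof. by apply/matrixP => i j; rewrite [LHS]mxE encK. Qed.

Lemma dmx_inj a b : injective (@dmx R a b).
Proof.
move=> t t' /matrixP h; apply: dec_inj => -[i j].
by have := h i j; rewrite !mxE.
Qed.

Lemma enrm_mx a b (t : cspace R ('I_a * 'I_b)%type) :
  enrm (ceuclid _) t = \sum_i \sum_j cn2 (dmx t i j).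
Proof.
rewrite enrm_cspace sum_pair.
by apply: eq_bigr => i _; apply: eq_bigr => j _; rewrite mxE.
Qed.

Lemma measurable_umul a b U : measurable_fun setT (@umul a b U).
Proof.
apply: measurable_enc => i; apply: cmeas_mulmx => j l; first exact: cmeas_cst.
exact: cmeas_dmx.
Qed.

Lemma umul_add a b U t t' : @umul a b U (eadd (ceuclid _) t t') =
  eadd (ceuclid _) (umul U t) (umul U t').
Proof. by apply: dmx_inj; rewrite dmx_add !dmx_umul dmx_add mulmxDr. Qed.

Lemma umul_surj a b (U : 'M[C]_a) t : ctmx U *m U = 1%:M ->
  exists t', @umul a b U t' = t.
Proof.
move=> hU; exists (umul (ctmx U) t); apply: dmx_inj.
by rewrite !dmx_umul mulmxA (mulmx1C hU) mul1mx.
Qed.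

Lemma enrm_umul a b (U : 'M[C]_a) t : ctmx U *m U = 1%:M ->
  enrm (ceuclid _) (@umul a b U t) = enrm (ceuclid _) t.
Proof. by move=> hU; rewrite !enrm_mx dmx_umul sum_cn2_unitary. Qed.

Lemma vnorm2_elast k : vnorm2 (elast : 'cV[C]_(k + 1)) = 1.
Proof.
rewrite /vnorm2 (bigD1 (rshift k ord0))//= mxE !eqxx cn21 big1 ?addr0// => i h.
by rewrite mxE (negPf h) cn20.
Qed.

End UnitaryAction.

Lemma le_mixture (R : realFieldType) (V w1 w2 s c a : R) :
  c * V <= s + c * a * (w1 * V) + c * (1 - a) * (w2 * V) ->
  c * (1 - a * w1 - (1 - a) * w2) * V <= s.
Proof. by move=> h; lra. Qed.

Lemma det0_gt0 (R : comNzRingType) n : (0 < n)%N -> \det (0 : 'M[R]_n) = 0.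
Proof. by case: n => // n _; exact: det0. Qed.

(** * The bordered determinant event, bounded by double counting *)

Section Core.
Context {R : realType} (p k : nat).
Local Notation C := R[i].
Hypothesis k0 : (0 < k)%N.
Let EF : euclid R _ := prod_euclid (ceuclid 'I_p) (ceuclid ('I_(k + 1) * 'I_k)%type).
Let Yg : euclid R _ := ceuclid ('I_(k + 1) * 'I_1)%type.
Let P := prod_euclid EF Yg.
Let T0 := (cspace R 'I_p * cspace R ('I_(k + 1) * 'I_k)%type)%type.
Let Tg := cspace R ('I_(k + 1) * 'I_1)%type.

Lemma cmeas_bdet d (T : measurableType d) (F : T -> 'M[C]_(k + 1, k))
    (g : T -> 'cV[C]_(k + 1)) :
  (forall i j, cmeas (fun x => F x i j)) -> (forall i j, cmeas (fun x => g x i j)) ->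
  cmeas (fun x => bdet (F x) (g x)).
Proof.
move=> mF mg; apply: cmeas_det => i j.
under [X in cmeas X]eq_fun do rewrite mxE.
by case: (fintype.split j).
Qed.

Let mF i j : cmeas (fun x : T0 => dmx x.2 i j) := cmeas_comp (cmeas_dmx i j) measurable_snd.
Let mg i j : cmeas (fun t : Tg => dmx t i j) := cmeas_dmx i j.

Lemma enrm_dmx (t : Tg) : enrm Yg t = vnorm2 (dmx t).
Proof.
rewrite enrm_cspace sum_pair.
by apply: eq_bigr => i _; rewrite big_ord1 mxE.
Qed.

Let v (x : T0) (i : 'I_(k + 1) * 'I_1) : C := bdet (dmx x.2) (delta_mx i.1 0).

Let bdetE (x : T0) (t : Tg) : bdet (dmx x.2) (dmx t) = \sum_i v x i * dec t i.
Proof.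
rewrite bdet_sum sum_pair.
by apply: eq_bigr => i _; rewrite big_ord1 mxE.
Qed.

Let mv i : cmeas (fun x => v x i).
Proof. by apply: cmeas_bdet => // a b; exact: cmeas_cst. Qed.

Let N x := \sum_i cn2 (v x i).

Let N_ge0 x : 0 <= N x. Proof. by rewrite sumr_ge0// => i _; exact: cn2_ge0. Qed.

Lemma evol_bdet_last_null :
  evol EF [set x | bdet (dmx x.2) (elast : 'cV[C]_(k + 1)) = 0] = 0%E.
Proof.
under eq_set do rewrite bdet_last.
apply: (@prod_null_snd _ _ _ _ _ _ _ [set t | \det (usubmx (@dmx R (k + 1) k t)) = 0]).
  apply: measurable_eq0_cn2; apply: cmeas_det => i j.
  by under [X in cmeas X]eq_fun do rewrite mxE; exact: cmeas_dmx.
exact: evol_singular_null.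
Qed.

Let N_null : evol EF [set x | N x = 0] = 0%E.
Proof.
apply/eqP; rewrite eq_le measure_ge0 andbT -evol_bdet_last_null.
apply: le_measure; rewrite ?inE.
- rewrite (_ : mkset _ = [set x | N x <= 0]).
    by apply: measurable_le_fun; [exact: measurable_sqnorm|exact: measurable_cst].
  by apply/seteqP; split=> x /= h; [rewrite h|apply/eqP; rewrite eq_le h N_ge0].
- by apply: measurable_eq0_cn2; apply: cmeas_bdet => // i j; exact: cmeas_cst.
- move=> x /= h; apply/eqP; rewrite -cn2_eq0; apply/eqP.
  have := psumr_eq0P (fun i _ => cn2_ge0 (v x i)) h.
  by move=> /(_ (rshift k ord0, ord0) isT).
Qed.

Let Kg_card : #|{: 'I_(k + 1) * 'I_1}| = (k + 1)%N.
Proof. by rewrite card_prod !card_ord muln1. Qed.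

(** The complex dimension of the pairs (e, F). Adding the k + 1 coordinates of g gives N, so that q
    + k is N - 1. *)
Let q := (p + (k + 1) * k)%N.

Let dimEF : edim EF = (q * 2)%N.
Proof. by rewrite /EF /= !edim_cspace card_prod !card_ord /q [RHS]mulnDl. Qed.

Let tail tau : 0 <= tau <= 1 ->
  evol P [set x | [/\ N x.1 <> 0, enrm P x <= 1 &
    cn2 (\sum_i v x.1 i * dec x.2 i) <= tau * (N x.1 * enrm P x)]] =
  ((1 - (1 - tau) ^+ (q + k)) * rvol P)%:E.
Proof.
move=> t01; have -> : (q + k)%N = (q + #|{: 'I_(k + 1) * 'I_1}|.-1)%N.
  by rewrite Kg_card addn1.
apply: evol_functional_tail => //; rewrite Kg_card; lia.
Qed.

Variable s2 : R.
Hypothesis s2_gt0 : 0 < s2.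

(** The event with u as border in place of the last basis vector, free of quotients; the factor
    [vnorm2 u] makes it invariant under scaling of u. *)
Let A' (u : 'cV[C]_(k + 1)) : set (T0 * Tg) :=
  [set x | enrm P x <= 1 /\ s2 * enrm P x * cn2 (bdet (dmx x.1.2) u) <=
                            cn2 (bdet (dmx x.1.2) (dmx x.2)) * vnorm2 u].

Let mbdet : cmeas (fun x : T0 * Tg => bdet (dmx x.1.2) (dmx x.2)).
Proof.
apply: cmeas_bdet => i j; first exact: (cmeas_comp (mF i j) measurable_fst).
exact: (cmeas_comp (mg i j) measurable_snd).
Qed.

Let mA' u : measurable (A' u).
Proof.
apply: measurableI; first exact: measurable_ball1.
apply: measurable_le_fun; apply: measurable_funM.
- by apply: measurable_funM; [exact: measurable_cst|exact: enrm_meas].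
- apply: measurable_cn2; apply: cmeas_bdet => i j; last exact: cmeas_cst.
  exact: (cmeas_comp (mF i j) measurable_fst).
- exact: measurable_cn2.
- exact: measurable_cst.
Qed.

(* Rotating the rows of the bordered matrix by a unitary U which sends the last
   basis vector to the direction of u. *)
Lemma evol_rotate (u : 'cV[C]_(k + 1)) : u != 0 ->
  evol P (A' u) = evol P (A' elast).
Proof.
move=> u0; have [U [hU uE]] := unitary_last u0.
have n0 : 0 < vnorm2 u.
  rewrite lt_neqAle sumr_ge0 ?andbT; last by move=> *; exact: cn2_ge0.
  by apply: contra u0; rewrite eq_sym => /eqP h; rewrite uE h sqrtr0 scale0r.
pose f (x : T0 * Tg) : T0 * Tg := ((x.1.1, umul U x.1.2), umul U x.2).
have fN x : enrm P (f x) = enrm P x.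
  by rewrite /P /EF /Yg /= !enrm_umul.
have dU0 : 0 < cn2 (\det U).
  rewrite lt_neqAle cn2_ge0 eq_sym cn2_eq0 andbT.
  have := congr1 determinant hU; rewrite det_mulmx det1 => /eqP.
  by apply: contraTneq => ->; rewrite mulr0 eq_sym oner_eq0.
rewrite (@evol_isometryE _ _ _ _ _ P P f).
- rewrite divff ?gt_eqF ?rvol_gt0// mul1e; congr (evol P _).
  have e1 x : cn2 (bdet (dmx (f x).1.2) u) =
      cn2 (\det U) * vnorm2 u * cn2 (bdet (dmx x.1.2) elast).
    by rewrite [in LHS]uE bdetZ dmx_umul bdet_mull !cn2M cn2_real sqr_sqrtr ?(ltW n0)//;
      ring.
  have e2 x : cn2 (bdet (dmx (f x).1.2) (dmx (f x).2)) =
      cn2 (\det U) * cn2 (bdet (dmx x.1.2) (dmx x.2)).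
    by rewrite !dmx_umul bdet_mull cn2M.
  have e3 x : (s2 * enrm P (f x) * cn2 (bdet (dmx (f x).1.2) u) <=
      cn2 (bdet (dmx (f x).1.2) (dmx (f x).2)) * vnorm2 u) =
      (s2 * enrm P x * cn2 (bdet (dmx x.1.2) elast) <=
       cn2 (bdet (dmx x.1.2) (dmx x.2)) * vnorm2 (elast : 'cV[C]_(k + 1))).
    rewrite fN e1 e2 vnorm2_elast mulr1.
    rewrite -[RHS](ler_pM2l (mulr_gt0 dU0 n0)).
    by congr (_ <= _); ring.
  by apply/seteqP; split=> x; rewrite /A' /mkset e3 fN.
- apply: measurable_fun_pair; first apply: measurable_fun_pair.
  + exact: measurableT_comp measurable_fst measurable_fst.
  + apply: (measurableT_comp (measurable_umul U)).
    exact: measurableT_comp measurable_snd measurable_fst.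
  + exact: (measurableT_comp (measurable_umul U) measurable_snd).
- by move=> x y; congr ((_, _), _); exact: umul_add.
- move=> [[e F] g]; have [F' hF] := umul_surj F hU; have [g' hg] := umul_surj g hU.
  by exists ((e, F'), g'); rewrite /f /= hF hg.
- exact: fN.
- exact: mA'.
Qed.

(** The probability over u of the condition when zeta equals z. The ratio z / s2 is capped at 1, the
    end of the range of the tail formula. *)
Let psi (z : R) : R := 1 - (1 - Num.min 1 (z / s2)) ^+ k.
Let zeta (x : T0 * Tg) : R :=
  cn2 (bdet (dmx x.1.2) (dmx x.2)) / (N x.1 * enrm P x).
(** The bound zeta <= 1 is imposed here as a condition rather than derived from Cauchy-Schwarz: this
    is the event of [tail] at tau = 1, which has the volume of the whole ball. *)
Let B0 : set (T0 * Tg) := [set x | [/\ N x.1 <> 0, enrm P x <= 1 &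
    cn2 (\sum_i v x.1 i * dec x.2 i) <= 1 * (N x.1 * enrm P x)]].

Let mN : measurable_fun setT N. Proof. exact: measurable_sqnorm. Qed.

Let mB0 : measurable B0.
Proof.
rewrite (_ : B0 = [set x | ~ (N x.1 <= 0)] `&` (ball1 P `&` [set x |
    cn2 (\sum_i v x.1 i * dec x.2 i) <= 1 * (N x.1 * enrm P x)])).
  have mN1 : measurable_fun setT (fun x : T0 * Tg => N x.1).
    exact: measurableT_comp mN measurable_fst.
  apply: measurableI; first apply: measurableC.
    by apply: measurable_le_fun => //; exact: measurable_cst.
  apply: measurableI; first exact: measurable_ball1.
  apply: measurable_le_fun.
    apply: measurable_cn2; apply: cmeas_sum => i; apply: cmeasM.
      exact: (cmeas_comp (mv i) measurable_fst).
    exact: (cmeas_comp (cmeas_dec i) measurable_snd).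
  apply: measurable_funM; first exact: measurable_cst.
  by apply: measurable_funM => //; exact: enrm_meas.
apply/seteqP; split=> x; rewrite /B0 /=.
  move=> [h ? ?]; split=> // h'; apply: h; apply/eqP.
  by rewrite eq_le h' N_ge0.
by move=> [h [? ?]]; split=> // h'; apply: h; rewrite h'.
Qed.

Let mzeta : measurable_fun setT zeta.
Proof.
apply: measurable_funM; first exact: measurable_cn2.
apply: measurable_inv_ge0 => [x|]; first by rewrite mulr_ge0 ?enrm_ge0.
apply: measurable_funM; last exact: enrm_meas.
exact: measurableT_comp mN measurable_fst.
Qed.

Let zeta01 x : B0 x -> 0 <= zeta x <= 1.
Proof.
move=> [Nx _ h]; have N0 : 0 < N x.1.
  by rewrite lt_neqAle N_ge0 andbT eq_sym; apply/eqP.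
have e0 := enrm_ge0 P x.
rewrite divr_ge0 ?cn2_ge0 ?mulr_ge0//=.
have [e1|e1] := eqVneq (enrm P x) 0; first by rewrite /zeta e1 mulr0 invr0 mulr0.
have e2 : 0 < N x.1 * enrm P x by rewrite mulr_gt0// lt_neqAle eq_sym e1.
by rewrite ler_pdivrMr// bdetE.
Qed.

Let mpsi : measurable_fun setT (fun x => psi (zeta x)).
Proof.
apply: measurable_funB; first exact: measurable_cst.
apply: measurable_funX; apply: measurable_funB; first exact: measurable_cst.
apply: measurable_minr; first exact: measurable_cst.
by apply: measurable_funM => //; exact: measurable_cst.
Qed.

Let psi_ge0 x : B0 x -> 0 <= psi (zeta x).
Proof.
move=> /zeta01/andP[z0 z1]; have z2 : 0 <= zeta x / s2 by rewrite divr_ge0// ltW.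
have t0 : 0 <= Num.min 1 (zeta x / s2) by rewrite le_min ler01.
have t1 : Num.min 1 (zeta x / s2) <= 1 by rewrite ge_min lexx.
by rewrite subr_ge0 exprn_ile1//; lra.
Qed.

(** The joint event of the perturbation and the auxiliary point, sliced in two ways: at fixed u
    every slice has the volume of [A' elast], at fixed x the slice is bounded below through [psi].
    The value u = 0 is left out, having no direction to rotate to. *)
Let W : set ((T0 * Tg) * Tg) := [set w | (0 < enrm Yg w.2 /\ enrm Yg w.2 <= 1) /\
  (enrm P w.1 <= 1 /\ s2 * enrm P w.1 * cn2 (bdet (dmx w.1.1.2) (dmx w.2)) <=
     cn2 (bdet (dmx w.1.1.2) (dmx w.1.2)) * enrm Yg w.2)].

Let mW : measurable W.
Proof.
have my : measurable_fun setT (fun w : (T0 * Tg) * Tg => enrm Yg w.2).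
  exact: measurable_enrm.
have mx : measurable_fun setT (fun w : (T0 * Tg) * Tg => enrm P w.1).
  exact: measurable_enrm.
apply: measurableI; apply: measurableI.
- by apply: measurable_lt_fun => //; exact: measurable_cst.
- by apply: measurable_le_fun => //; exact: measurable_cst.
- by apply: measurable_le_fun => //; exact: measurable_cst.
apply: measurable_le_fun; apply: measurable_funM => //.
- by apply: measurable_funM => //; exact: measurable_cst.
- apply: measurable_cn2; apply: cmeas_bdet => i j.
    apply: (cmeas_comp (cmeas_comp (mF i j) measurable_fst)).
    exact: measurable_fst.
  exact: (cmeas_comp (mg i j) measurable_snd).
- exact: (measurableT_comp (measurable_cn2 mbdet) measurable_fst).
Qed.

Let evol_W_le : (evol (prod_euclid P Yg) W <= evol P (A' elast) * (rvol Yg)%:E)%E.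
Proof.
pose O : set Tg := [set u | 0 < enrm Yg u /\ enrm Yg u <= 1].
have mO : measurable O.
  apply: measurableI; last exact: measurable_ball1.
  by apply: measurable_lt_fun; [exact: measurable_cst|exact: enrm_meas].
rewrite prod_evol_swap//.
have -> : (\int[evol Yg]_u evol P (ysection W u) =
           \int[evol Yg]_u (evol P (A' elast) * (\1_O u)%:E))%E.
  apply: eq_integral => u _; rewrite ysectionE indicE.
  have [Ou|nOu] := pselect (O u); last first.
    rewrite memNset// mule0 (_ : _ @^-1` _ = set0) ?measure0//.
    by apply/seteqP; split=> x // -[].
  rewrite mem_set// mule1 -(@evol_rotate (dmx u)).
    congr (evol P _); apply/seteqP; split=> x; rewrite /W /A' /= -enrm_dmx.
      by move=> [].
    by [].
  apply/eqP => u0; case: Ou; rewrite enrm_dmx u0 /vnorm2 big1 ?ltxx//.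
  by move=> i _; rewrite mxE cn20.
rewrite ge0_integralZl//; last 1 first.
- by apply/measurable_EFinP; exact: measurable_indic.
rewrite integral_indic// setIT lee_wpmul2l// -rvolE.
by apply: le_measure; rewrite ?inE//; [exact: measurable_ball1|move=> u []].
Qed.

Let evol_W_ge :
  (\int[evol P]_(x in B0) ((psi (zeta x))%:E * (rvol Yg)%:E) <=
   evol (prod_euclid P Yg) W)%E.
Proof.
change (\int[evol P]_(x in B0) ((psi (zeta x))%:E * (rvol Yg)%:E) <=
  \int[evol P]_x (evol Yg \o xsection W) x)%E.
have mxs := measurable_fun_xsection (evol Yg) mW.
have mpr : measurable_fun setT (fun x => (psi (zeta x))%:E * (rvol Yg)%:E)%E.
  by apply: emeasurable_funM; [exact/measurable_EFinP|exact: measurable_cst].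
have pr0 x : B0 x -> (0 <= (psi (zeta x))%:E * (rvol Yg)%:E)%E.
  move=> Bx; rewrite mule_ge0// lee_fin ?psi_ge0//.
  exact/ltW/rvol_gt0.
apply: (@le_trans _ _ (\int[evol P]_(x in B0) (evol Yg \o xsection W) x)%E).
  apply: ge0_le_integral => //.
  - exact: measurable_funTS.
  - exact: measurable_funTS.
  move=> x Bx; rewrite /= xsectionE -EFinM.
  have /andP[z0 z1] := zeta01 Bx; have [Nx e1 _] := Bx.
  have z2 : 0 <= zeta x / s2 by rewrite divr_ge0// ltW.
  pose t := Num.min 1 (zeta x / s2).
  have t0 : 0 <= t by rewrite le_min ler01.
  have t1 : t <= 1 by rewrite ge_min lexx.
  have tz : t <= zeta x / s2 by rewrite ge_min lexx orbT.
  have K1 : (1 < #|{: 'I_(k + 1) * 'I_1}|)%N by rewrite Kg_card addn1 ltnS.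
  have H : evol Yg [set u | enrm Yg u <= 1 /\
      cn2 (\sum_i v x.1 i * dec u i) <= t * (N x.1 * enrm Yg u)] =
      (psi (zeta x) * rvol Yg)%:E.
    have -> : psi (zeta x) = 1 - (1 - t) ^+ #|{: 'I_(k + 1) * 'I_1}|.-1.
      by rewrite Kg_card addn1.
    by apply: evol_linear_tail => //; [exact/eqP|rewrite t0 t1].
  rewrite -H.
  have mL : measurable [set u : Tg | enrm Yg u <= 0].
    by apply: measurable_le_fun; [exact: enrm_meas|exact: measurable_cst].
  have mWx : measurable ((fun y => (x, y)) @^-1` W).
    exact: (measurable_preim (pair1_measurable x) mW).
  have O0 : evol Yg [set u : Tg | enrm Yg u <= 0] = 0%E.
    by apply: (@evol_origin R _ (v x.1)) => //; exact/eqP.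
  (* The null set of the origin, left out of W, is added back before comparing with the tail set. *)
  apply: (@le_trans _ _ (evol Yg ((fun y => (x, y)) @^-1` W `|`
                                  [set u | enrm Yg u <= 0]))).
    apply: le_measure; rewrite ?inE; last 1 first.
    - move=> u [u1 u2]; have [u3|u3] := leP (enrm Yg u) 0; [by right|left].
      split=> //; split=> //.
      change (s2 * enrm P x * cn2 (bdet (dmx x.1.2) (dmx u)) <=
              cn2 (bdet (dmx x.1.2) (dmx x.2)) * enrm Yg u); rewrite bdetE.
      have e0 := enrm_ge0 P x.
      have [e2|e2] := eqVneq (enrm P x) 0.
        by rewrite e2 mulr0 mul0r mulr_ge0 ?cn2_ge0 ?enrm_ge0.
      have e3 : 0 < enrm P x by rewrite lt_neqAle eq_sym e2.
      have N0 : 0 < N x.1.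
        by rewrite lt_neqAle N_ge0 andbT eq_sym; apply/eqP.
      have u4 : cn2 (\sum_i v x.1 i * dec u i) <= zeta x / s2 * (N x.1 * enrm Yg u).
        by rewrite (le_trans u2)// ler_wpM2r// mulr_ge0 ?enrm_ge0.
      have s3 : 0 < s2 * enrm P x by rewrite mulr_gt0.
      apply: (le_trans (ler_wpM2l (ltW s3) u4)).
      rewrite le_eqVlt; apply/orP; left; apply/eqP; rewrite /zeta; field.
      by rewrite !gt_eqF.
    - apply: measurableI; first exact: measurable_ball1.
      apply: measurable_le_fun.
        apply: measurable_cn2; apply: cmeas_sum => i.
        by apply: cmeasM; [exact: cmeas_cst|exact: cmeas_dec].
      by do 2 (apply: measurable_funM; first exact: measurable_cst); exact: enrm_meas.
    - exact: measurableU.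
  apply: (le_trans (measureU2 _ _ _)) => //.
  by rewrite [X in (_ + X)%E]O0 ?adde0.
by apply: ge0_subset_integral.
Qed.

Lemma integral_psi_le :
  (\int[evol P]_(x in B0) (psi (zeta x))%:E <= evol P (A' elast))%E.
Proof.
have V0 := rvol_gt0 Yg.
rewrite -(@lee_pmul2r _ (rvol Yg)%:E) ?lte_fin//.
apply: le_trans evol_W_le; apply: le_trans evol_W_ge.
have V1 : (0 <= (rvol Yg)%:E)%E by rewrite lee_fin ltW.
rewrite ge0_integralZr//.
- by apply/measurable_EFinP/measurable_funTS.
Qed.

Let zeta_tail r : 0 <= r <= 1 ->
  evol P (B0 `&` [set x | zeta x <= r]) = ((1 - (1 - r) ^+ (q + k)) * rvol P)%:E.
Proof.
move=> r01; rewrite -tail//; congr (evol P _); have /andP[r0 r1] := r01.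
have NP x : 0 <= N x.1 * enrm P x by rewrite mulr_ge0 ?enrm_ge0.
apply/seteqP; split=> x.
  move=> [[Nx e1 h] h']; split=> //; rewrite mul1r in h.
  have [e2|e2] := eqVneq (N x.1 * enrm P x) 0.
    by rewrite (le_trans h)// e2 mulr0.
  rewrite /zeta /= bdetE in h'.
  by rewrite -ler_pdivrMr// lt_neqAle eq_sym e2 NP.
move=> [Nx e1 h]; split.
  by split=> //; rewrite (le_trans h)// ler_wpM2r.
rewrite /zeta /= bdetE.
have [e2|e2] := eqVneq (N x.1 * enrm P x) 0; first by rewrite e2 invr0 mulr0.
by rewrite ler_pdivrMr// lt_neqAle eq_sym e2 NP.
Qed.

Let evol_B0 : evol P B0 = (rvol P)%:E.
Proof. by rewrite /B0 tail ?lexx ?ler01// subrr expr0n gtn_eqF ?subr0 ?mul1r// addn_gt0 k0 orbT. Qed.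

Let moment j : (0 < j)%N ->
  (\int[evol P]_(x in B0) ((1 - zeta x) ^+ j)%:E =
   ((q + k)%:R / (q + k + j)%:R * rvol P)%:E)%E.
Proof.
move=> j0; apply: integral_tail_power => //; exact: ltW (rvol_gt0 P).
Qed.

Let mpow j : measurable_fun B0 (fun x => ((1 - zeta x) ^+ j)%:E).
Proof.
apply/measurable_funTS/measurable_EFinP/measurable_funX.
by apply: measurable_funB => //; exact: measurable_cst.
Qed.

Let pow_ge0 j x : B0 x -> (0 <= ((1 - zeta x) ^+ j)%:E)%E.
Proof.
by move=> /zeta01/andP[z0 z1]; rewrite lee_fin exprn_ge0// subr_ge0.
Qed.

(** A pointwise lower bound for [psi], integrated with two moments of 1 - zeta. The moments stand on
    the side of [psi], so that only nonnegative functions are integrated. The weight [a] divides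
    them between the orders k and k + 1: a = 1 serves s >= 1, and the share of order k + 1 brings
    strictness for s < 1. *)
Lemma evol_bordered_ge (c a : R) : 0 <= c -> 0 <= a <= 1 ->
  (forall z, 0 <= z <= 1 ->
    c <= psi z + (c * a) * (1 - z) ^+ k + (c * (1 - a)) * (1 - z) ^+ (k + 1)) ->
  ((c * (1 - a * ((q + k)%:R / (q + k + k)%:R)
           - (1 - a) * ((q + k)%:R / (q + k + (k + 1))%:R)) * rvol P)%:E
    <= evol P (A' elast))%E.
Proof.
move=> c0 /andP[a0 a1] h; apply: le_trans integral_psi_le.
have ca0 : 0 <= c * a by rewrite mulr_ge0.
have ca1 : 0 <= c * (1 - a) by rewrite mulr_ge0 ?subr_ge0.
have mps : measurable_fun B0 (fun x => (psi (zeta x))%:E).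
  by apply/measurable_funTS/measurable_EFinP.
have ps0 x : B0 x -> (0 <= (psi (zeta x))%:E)%E.
  by move=> Bx; rewrite lee_fin psi_ge0.
pose f0 x := (psi (zeta x))%:E.
pose f1 x := ((c * a)%:E * ((1 - zeta x) ^+ k)%:E)%E.
pose f2 x := ((c * (1 - a))%:E * ((1 - zeta x) ^+ (k + 1))%:E)%E.
have mf1 : measurable_fun B0 f1 by apply: measurable_funeM; exact: mpow.
have mf2 : measurable_fun B0 f2 by apply: measurable_funeM; exact: mpow.
have f1_ge0 x : B0 x -> (0 <= f1 x)%E.
  by move=> Bx; apply: mule_ge0; [rewrite lee_fin|exact: pow_ge0].
have f2_ge0 x : B0 x -> (0 <= f2 x)%E.
  by move=> Bx; apply: mule_ge0; [rewrite lee_fin|exact: pow_ge0].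
have I1 : (\int[evol P]_(x in B0) f1 x =
    ((c * a) * ((q + k)%:R / (q + k + k)%:R * rvol P))%:E)%E.
  rewrite EFinM -(moment k0); apply: ge0_integralZl;
    [exact: mB0|exact: mpow|exact: pow_ge0|by rewrite lee_fin].
have I2 : (\int[evol P]_(x in B0) f2 x =
    ((c * (1 - a)) * ((q + k)%:R / (q + k + (k + 1))%:R * rvol P))%:E)%E.
  rewrite EFinM -moment ?addn1//; apply: ge0_integralZl;
    [exact: mB0|exact: mpow|exact: pow_ge0|by rewrite lee_fin].
have D1 : (\int[evol P]_(x in B0) (f0 x + f1 x) =
    \int[evol P]_(x in B0) f0 x + \int[evol P]_(x in B0) f1 x)%E.
  by apply: ge0_integralD; [exact: mB0|exact: ps0|exact: mps|exact: f1_ge0|exact: mf1].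
have D2 : (\int[evol P]_(x in B0) (f0 x + f1 x + f2 x) =
    \int[evol P]_(x in B0) (f0 x + f1 x) + \int[evol P]_(x in B0) f2 x)%E.
  apply: ge0_integralD;
    [exact: mB0| |exact: emeasurable_funD|exact: f2_ge0|exact: mf2].
  by move=> x Bx; apply: adde_ge0; [exact: ps0|exact: f1_ge0].
have key : ((c * rvol P)%:E <= \int[evol P]_(x in B0) f0 x +
    ((c * a) * ((q + k)%:R / (q + k + k)%:R * rvol P))%:E +
    ((c * (1 - a)) * ((q + k)%:R / (q + k + (k + 1))%:R * rvol P))%:E)%E.
  rewrite -I1 -I2 -D1 -D2 EFinM -evol_B0 -integral_cst//.
  apply: ge0_le_integral => //.
  - by apply: emeasurable_funD => //; exact: emeasurable_funD.
  - by move=> x Bx; rewrite /f0 /f1 /f2 -!EFinM -!EFinD lee_fin; apply: h; exact: zeta01.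
change (((c * (1 - a * ((q + k)%:R / (q + k + k)%:R) - (1 - a) *
  ((q + k)%:R / (q + k + (k + 1))%:R)) * rvol P)%:E <= \int[evol P]_(x in B0) f0 x)%E).
move: key; case: (\int[evol P]_(x in B0) f0 x)%E => [s| |].
- rewrite -!EFinD !lee_fin; exact: le_mixture.
- by move=> _; exact: leey.
- by rewrite !addNye leeNy_eq.
Qed.

Lemma enrm_eq0_bdet x : enrm P x <= 0 -> bdet (dmx x.1.2) (elast : 'cV[C]_(k + 1)) = 0.
Proof.
move=> h; rewrite bdet_last (_ : dmx x.1.2 = 0).
  by rewrite linear0 det0_gt0.
apply/matrixP => i j; rewrite !mxE; apply/eqP; rewrite -cn2_eq0 eq_le cn2_ge0 andbT.
apply: le_trans h; rewrite /P /EF /=.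
have h1 := enrm_ge0 (ceuclid 'I_p) x.1.1; have h2 := enrm_ge0 Yg x.2.
suff : cn2 (dec x.1.2 (i, j)) <= enrm (ceuclid ('I_(k + 1) * 'I_k)%type) x.1.2 by lra.
by rewrite enrm_cspace (bigD1 (i, j))//= lerDl sumr_ge0// => l _; exact: cn2_ge0.
Qed.

(** Where the corner is singular, in particular at the zero perturbation, division by zero makes the
    sensitivity 0; these points form a null set and are discarded. *)
Lemma evol_bordered_generic :
  (evol P (A' elast) <= evol P [set x | [/\ 0 < enrm P x <= 1,
     bdet (dmx x.1.2) (elast : 'cV[C]_(k + 1)) != 0 &
     s2 * enrm P x * cn2 (bdet (dmx x.1.2) elast) <=
       cn2 (bdet (dmx x.1.2) (dmx x.2))]]%R)%E.
Proof.
set S := [set x | _].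
pose Z : set (T0 * Tg) := [set x | bdet (dmx x.1.2) (elast : 'cV[C]_(k + 1)) = 0].
have mZ0 : measurable [set x : T0 | bdet (dmx x.2) (elast : 'cV[C]_(k + 1)) = 0].
  by apply: measurable_eq0_cn2; apply: cmeas_bdet => // i j; exact: cmeas_cst.
have mZ : measurable Z by exact: (measurable_preim measurable_fst mZ0).
have Z0 : evol P Z = 0%E by exact: (prod_null_fst Yg mZ0 evol_bdet_last_null).
have SE : S = A' elast `\` Z.
  apply/seteqP; split=> x.
    move=> [/andP[e0 e1] /eqP b0 h]; split=> //.
    by split=> //; rewrite vnorm2_elast mulr1.
  move=> [[e1 h] b0]; split; last by rewrite vnorm2_elast mulr1 in h.
    rewrite e1 andbT ltNge; apply/negP => e0; apply: b0; exact: enrm_eq0_bdet.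
  exact/eqP.
have mS : measurable S by rewrite SE; apply: measurableD => //; exact: mA'.
apply: (@le_trans _ _ (evol P (S `|` Z))).
  apply: le_measure; rewrite ?inE; [exact: mA'|exact: measurableU|].
  by move=> x Ax; have [Zx|Zx] := pselect (Z x); [right|left; rewrite SE].
by apply: (le_trans (measureU2 _ mS mZ)); rewrite [X in (_ + X)%E]Z0 ?adde0.
Qed.

End Core.

(** * Elementary inequalities for the conditional probability *)

Section Numeric.
Context {R : realType}.

(** As a function of theta the left side is convex, and the right side is its chord between 0 and
    1. *)
Lemma expr_chord (theta z : R) k : 0 <= theta <= 1 -> 0 <= z <= 1 ->
  (1 - theta * z) ^+ k <= 1 - theta + theta * (1 - z) ^+ k.
Proof.
move=> /andP[t0 t1] /andP[z0 z1]; elim: k => [|k IH]; first by rewrite !expr0; lra.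
rewrite !exprS; set y := (1 - z) ^+ k in IH *.
have y1 : y <= 1 by rewrite /y exprn_ile1//; lra.
have h : 0 <= 1 - theta * z by nra.
apply: (le_trans (ler_wpM2l h IH)); rewrite -subr_ge0.
have -> : 1 - theta + theta * ((1 - z) * y) - (1 - theta * z) * (1 - theta + theta * y)
  = (1 - theta) * theta * (z * (1 - y)) by ring.
by rewrite !mulr_ge0//; lra.
Qed.

(** Here z / s2 >= (1 + eta) z, and 1 - (1 + eta) z falls short of (1 - z)(1 - eta z) by eta z^2. *)
Lemma min_quot_le (s2 eta z : R) : 0 < s2 -> 0 <= eta -> eta <= 1 -> s2 * (1 + eta) <= 1 ->
  0 <= z <= 1 -> 1 - Num.min 1 (z / s2) <= (1 - z) * (1 - eta * z).
Proof.
move=> s0 e0 e1 se /andP[z0 z1].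
have zs : z * (1 + eta) <= z / s2.
  by rewrite ler_pdivlMr//; nra.
have [h|h] := leP 1 (z / s2).
  by rewrite subrr mulr_ge0; nra.
by nra.
Qed.

(** Of the k factors 1 - eta z only one is kept; written as (1 - eta) + eta (1 - z), it divides the
    bound between the powers k and k + 1. *)
Lemma mixture_small (s2 eta z : R) k : (0 < k)%N -> 0 < s2 -> 0 <= eta -> eta <= 1 ->
  s2 * (1 + eta) <= 1 -> 0 <= z <= 1 ->
  1 <= 1 - (1 - Num.min 1 (z / s2)) ^+ k + (1 * (1 - eta)) * (1 - z) ^+ k +
       (1 * (1 - (1 - eta))) * (1 - z) ^+ (k + 1).
Proof.
move=> k0 s0 e0 e1 se z01; have hb := min_quot_le s0 e0 e1 se z01.
move: z01 => /andP[z0 z1].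
have zs : 0 <= z / s2 by rewrite divr_ge0// ltW.
have b0 : 0 <= 1 - Num.min 1 (z / s2) by rewrite subr_ge0 ge_min lexx.
have ez0 : 0 <= 1 - eta * z by nra.
have ez1 : 1 - eta * z <= 1 by nra.
have h : (1 - Num.min 1 (z / s2)) ^+ k <= (1 - z) ^+ k * (1 - eta * z).
  apply: (@le_trans _ _ (((1 - z) * (1 - eta * z)) ^+ k)).
    by rewrite lerXn2r// nnegrE// mulr_ge0// subr_ge0.
  rewrite exprMn ler_wpM2l ?exprn_ge0 ?subr_ge0//.
  case: k k0 => // k _; rewrite exprS ler_piMr// exprn_ile1//.
rewrite addn1 exprS; set y := (1 - z) ^+ k in h *.
nra.
Qed.

Lemma mixture_large (s2 z : R) k : 1 <= s2 -> 0 <= z <= 1 ->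
  s2^-1 <= 1 - (1 - Num.min 1 (z / s2)) ^+ k + (s2^-1 * 1) * (1 - z) ^+ k +
       (s2^-1 * (1 - 1)) * (1 - z) ^+ (k + 1).
Proof.
move=> s1 z01; have s0 : 0 < s2 by rewrite (lt_le_trans _ s1).
have t01 : 0 <= s2^-1 <= 1 by rewrite invr_ge0 (ltW s0) invf_le1.
have := expr_chord k t01 z01; move: z01 => /andP[z0 z1].
have -> : Num.min 1 (z / s2) = s2^-1 * z.
  by rewrite mulrC min_r// mulrC ler_pdivrMr// mul1r (le_trans z1).
rewrite subrr mulr0 mul0r addr0 mulr1; lra.
Qed.

End Numeric.

(** * A strict lower bound for the bordered event *)

Section BorderedBound.
Context {R : realType} (p k : nat).
Hypothesis k0 : (0 < k)%N.
Let X := prod_euclid (prod_euclid (@ceuclid R 'I_p) (ceuclid ('I_(k + 1) * 'I_k)%type))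
                     (ceuclid ('I_(k + 1) * 'I_1)%type).
Let M : R := (p + (k + 1) * k + k)%:R.
Let K : R := k%:R.

Lemma measurable_bordered (s2 : R) : measurable [set x | [/\ 0 < enrm X x <= 1,
  bdet (dmx x.1.2) elast != 0 &
  s2 * enrm X x * cn2 (bdet (dmx x.1.2) elast) <= cn2 (bdet (dmx x.1.2) (dmx x.2))]].
Proof.
set S := [set x | _].
have mF a b : cmeas (fun x : (cspace R 'I_p * cspace R ('I_(k + 1) * 'I_k)%type) *
    cspace R ('I_(k + 1) * 'I_1)%type => dmx x.1.2 a b).
  apply: (cmeas_comp (cmeas_dmx a b)).
  exact: measurableT_comp measurable_snd measurable_fst.
have ml := cmeas_bdet mF (fun a b => @cmeas_cst R _ _ ((elast : 'cV[R[i]]_(k + 1)) a b)).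
have mg := cmeas_bdet mF (fun a b => cmeas_comp (cmeas_dmx a b) measurable_snd).
rewrite (_ : S = [set x | 0 < enrm X x] `&` ball1 X `&`
  ~` [set x | bdet (dmx x.1.2) elast = 0] `&`
  [set x | s2 * enrm X x * cn2 (bdet (dmx x.1.2) elast) <=
           cn2 (bdet (dmx x.1.2) (dmx x.2))]).
  apply: measurableI; last first.
    apply: measurable_le_fun; last exact: measurable_cn2.
    apply: measurable_funM; last exact: measurable_cn2.
    by apply: measurable_funM; [exact: measurable_cst|exact: enrm_meas].
  apply: measurableI; last exact/measurableC/measurable_eq0_cn2.
  apply: measurableI; last exact: measurable_ball1.
  by apply: measurable_lt_fun; [exact: measurable_cst|exact: enrm_meas].
apply/seteqP; split=> x.
  by move=> [/andP[? ?] /eqP ? ?]; split=> //; split=> //; split.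
by move=> [[[h1 h2] h3] h4]; split=> //; [rewrite h1 h2|exact/eqP].
Qed.

(** The moments give K / (M + K) at s2 = 1, and the threshold is this times M / (M + K - 1). For s2
    >= 1 the strict inequality comes from the hypothesis on s2 * delta; for s2 < 1 the fraction has
    to exceed K / (M + K) itself, since the threshold equals it when K = 1. *)
Lemma evol_bordered_gt (s2 delta : R) : 0 < s2 -> 0 < delta ->
  delta <= M * K / ((M + K - 1) * (M + K)) ->
  s2 * delta < M * K / ((M + K - 1) * (M + K)) ->
  exists2 b, delta < b & ((b * rvol X)%:E <=
    evol X [set x | [/\ 0 < enrm X x <= 1,
     bdet (dmx x.1.2) elast != 0 &
     s2 * enrm X x * cn2 (bdet (dmx x.1.2) elast) <=
       cn2 (bdet (dmx x.1.2) (dmx x.2))]]%R)%E.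
Proof.
move=> s0 d0 dle dlt.
have K1 : 1 <= K by rewrite /K ler1n.
have M1 : 1 <= M by rewrite /M ler1n addn_gt0 k0 orbT.
have le1 : M * K / ((M + K - 1) * (M + K)) <= K / (M + K).
  rewrite [leRHS](_ : _ = (M + K - 1) * K / ((M + K - 1) * (M + K))); last first.
    by field; apply/andP; split; lra.
  by rewrite ler_pM2r ?invr_gt0 ?mulr_gt0 ?ler_pM2r//; lra.
have MkE : (p + (k + 1) * k + k + k)%:R = M + K :> R by rewrite natrD.
have MkE1 : (p + (k + 1) * k + k + (k + 1))%:R = M + K + 1 :> R.
  by rewrite addnA natrD MkE.
have [s1|s1] := leP 1 s2.
  exists (K / (s2 * (M + K))).
    rewrite invfM mulrA mulrAC ltr_pdivlMr// mulrC.
    exact: lt_le_trans le1.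
  apply: le_trans (evol_bordered_generic p k0 s2).
  have := @evol_bordered_ge R p k k0 s2 s0 s2^-1 1.
  rewrite invr_ge0 (ltW s0) ler01 lexx => /(_ isT isT (fun z => mixture_large k s1)).
  apply: le_trans; rewrite lee_fin ler_wpM2r ?(ltW (rvol_gt0 _))//.
  rewrite MkE MkE1 -/M le_eqVlt; apply/orP; left; apply/eqP.
  by field; rewrite (gt_eqF s0)/=; lra.
(* The largest eta <= 1 with s2 (1 + eta) <= 1, positive because s2 < 1. *)
pose eta := Num.min 1 (s2^-1 - 1).
have e0 : 0 < eta by rewrite lt_min ltr01 subr_gt0 invf_gt1.
have e1 : eta <= 1 by rewrite ge_min lexx.
have se : s2 * (1 + eta) <= 1.
  have : eta <= s2^-1 - 1 by rewrite ge_min lexx orbT.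
  rewrite -(ler_pM2l s0) mulrBr divff ?gt_eqF// => h; lra.
(* One minus a mixture of the moments M / (M + K) and M / (M + K + 1); the second is strictly
   smaller and has the positive weight eta. *)
pose b := 1 * (1 - (1 - eta) * (M / (M + K)) - (1 - (1 - eta)) * (M / (M + K + 1))).
exists b.
  apply: (le_lt_trans dle); apply: (le_lt_trans le1).
  have -> : K / (M + K) = 1 - M / (M + K) by field; lra.
  have h : M / (M + K + 1) < M / (M + K).
    by rewrite ltr_pM2l ?ltf_pV2 ?posrE//; lra.
  rewrite /b; nra.
apply: le_trans (evol_bordered_generic p k0 s2).
have := @evol_bordered_ge R p k k0 s2 s0 1 (1 - eta).
rewrite ler01 subr_ge0 e1 gerBl (ltW e0) => /(_ isT isT).
move=> /(_ (fun z => mixture_small k0 s0 (ltW e0) e1 se)).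
by rewrite MkE MkE1 -/M.
Qed.

End BorderedBound.

(** * Perturbations of a matrix polynomial *)

Section Perturbation.
Context {R : realType} (n m k : nat).
Local Notation C := R[i].
Variables (X Y : 'M[C]_(n, k)) (x y : 'cV[C]_n) (z0 : C).
Let KE : finType := ('I_m.+1 * 'I_n * 'I_n)%type.

Definition emat (t : cspace R KE) : 'I_m.+1 -> 'M[C]_n :=
  fun i => \matrix_(a, b) dec t (i, a, b).

Lemma realvecE (E : 'I_m.+1 -> 'M[C]_n) :
  realvec E = enc (fun p : KE => E p.1.1 p.1.2 p.2).
Proof. by congr codom_tuple; apply/funext => -[[[i a] b] c]. Qed.

Lemma emat_realvec (E : 'I_m.+1 -> 'M[C]_n) : emat (realvec E) = E.
Proof.
apply/funext => i; apply/matrixP => a b.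
by rewrite mxE realvecE encK.
Qed.

Lemma mpnorm_emat t : mpnorm (emat t) = Num.sqrt (enrm (ceuclid KE) t).
Proof.
rewrite /mpnorm; congr Num.sqrt; rewrite enrm_cspace !sum_pair.
apply: eq_bigr => i _; rewrite sqr_sqrtr; last first.
  by apply: sumr_ge0 => a _; apply: sumr_ge0 => b _; exact: sqr_ge0.
by apply: eq_bigr => a _; apply: eq_bigr => b _; rewrite normc_sq mxE.
Qed.

Definition compress (t : cspace R KE) : 'M[C]_(k + 1) :=
  ctmx (row_mx Y y) *m mpeval (emat t) z0 *m row_mx X x.

Definition zscale : R := \sum_(j < m.+1) normc z0 ^+ (2 * j).

Lemma zscale_gt0 : 0 < zscale.
Proof.
rewrite /zscale big_ord_recl muln0 expr0 ltr_pwDl// sumr_ge0// => i _.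
by rewrite exprn_ge0// normcE2 sqrtr_ge0.
Qed.

Lemma compressE t a b : compress t a b =
  \sum_(i < m.+1) \sum_c \sum_d
    z0 ^+ i * conjc (row_mx Y y c a) * row_mx X x d b * dec t (i, c, d).
Proof.
rewrite /compress mxE; under eq_bigr do rewrite mxE mulr_suml.
rewrite exchange_big /= [RHS]exchange_big /=; apply: eq_bigr => c _.
rewrite [RHS]exchange_big /=; apply: eq_bigr => d _.
rewrite /mpeval summxE mulr_sumr mulr_suml; apply: eq_bigr => i _.
by rewrite !mxE; ring.
Qed.

Hypothesis oX : orthonormal_cols (row_mx X x).
Hypothesis oY : orthonormal_cols (row_mx Y y).

Lemma orthonormal_colsE p q (U : 'M[C]_(p, q)) j j' : orthonormal_cols U ->
  \sum_i conjc (U i j) * U i j' = (j == j')%:R.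
Proof.
move=> /matrixP/(_ j j'); rewrite !mxE => <-.
by apply: eq_bigr => i _; rewrite !mxE.
Qed.

(** The entries of [compress], divided by the square root of [zscale], as linear forms in the
    entries of the perturbation. *)
Let L (j : 'I_(k + 1) * 'I_(k + 1)) (p : KE) : C :=
  (Num.sqrt zscale)^-1%:C%C *
    (z0 ^+ p.1.1 * conjc (row_mx Y y p.1.2 j.1) * row_mx X x p.2 j.2).

(** The sum factors into the sum of the |z0|^(2i), which is [zscale], and the Gram matrices of the
    two orthonormal families. *)
Let L_orthonormal j j' : \sum_p L j p * conjc (L j' p) = (j == j')%:R.
Proof.
have s0 := zscale_gt0.
rewrite !sum_pair.
transitivity ((zscale)^-1%:C%C *
  (\sum_(i < m.+1) (normc z0 ^+ (2 * i))%:C%C) *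
  (\sum_c conjc (row_mx Y y c j.1) * row_mx Y y c j'.1) *
  (\sum_d conjc (row_mx X x d j'.2) * row_mx X x d j.2)).
  rewrite [X in X * _ * _]mulr_sumr !mulr_suml; apply: eq_bigr => i _.
  rewrite -mulrA big_distrlr /= mulr_sumr; apply: eq_bigr => c _.
  rewrite mulr_sumr; apply: eq_bigr => d _.
  have [s sJ sE] : exists2 s : C, conjc s = s & s = (Num.sqrt zscale)^-1%:C%C.
    by exists (Num.sqrt zscale)^-1%:C%C => //; exact: conjc_real.
  have conjE (u v w : C) : conjc (s * (u * conjc v * w)) = s * (conjc u * v * conjc w).
    by rewrite !rmorphM /= conjcK sJ.
  rewrite /L -sE -[(i, c, d).1.1]/i -[(i, c, d).1.2]/c -[(i, c, d).2]/d.
  rewrite conjE.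
  have -> : (zscale)^-1%:C%C = s * s.
    by rewrite sE -rmorphM /= -invfM -expr2 sqr_sqrtr// ltW.
  have -> : (normc z0 ^+ (2 * i))%:C%C = z0 ^+ i * conjc (z0 ^+ i).
    by rewrite mul_conjc cn2X exprM normc_sq.
  move: (conjc (z0 ^+ i)) => w; ring.
rewrite !orthonormal_colsE// -rmorph_sum -rmorphM /= -/zscale mulVf ?(gt_eqF s0)//.
rewrite rmorph1 mul1r; case: j j' => a b [a' b'] /=.
by rewrite -pair_eqE /= (eq_sym b') -natrM mulnb.
Qed.

(** The (k + 1)^2 rescaled entries serve as coordinates [F g], completed by p further ones. The
    remaining factor, the square root of [zscale], is the denominator of [gammaP]. *)
Lemma compress_isometry : exists p, (p + (k + 1) * (k + 1) = m.+1 * n * n)%N /\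
  let V := prod_euclid (prod_euclid (@ceuclid R 'I_p) (ceuclid ('I_(k + 1) * 'I_k)%type))
                     (ceuclid ('I_(k + 1) * 'I_1)%type) in
  exists f, [/\ measurable_fun setT f,
    forall u w, f (eadd V u w) = eadd (ceuclid KE) (f u) (f w),
    forall t, exists u, f u = t,
    forall u, enrm (ceuclid KE) (f u) = enrm V u
  & forall u, compress (f u) =
      (Num.sqrt zscale)%:C%C *: row_mx (dmx u.1.2) (dmx u.2)].
Proof.
have [p [W [e1]]] := isometry_extension L_orthonormal.
set h := (fun a e k => _) => -[hL hN hS].
exists p; split; first by rewrite !card_prod !card_ord in e1.
pose V := prod_euclid (prod_euclid (@ceuclid R 'I_p) (ceuclid ('I_(k + 1) * 'I_k)%type))
                     (ceuclid ('I_(k + 1) * 'I_1)%type).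
pose T := ((cspace R 'I_p * cspace R ('I_(k + 1) * 'I_k)) *
           cspace R ('I_(k + 1) * 'I_1))%type.
pose G (u : T) := row_mx (dmx u.1.2) (dmx u.2).
pose a (u : T) (j : 'I_(k + 1) * 'I_(k + 1)) : C := G u j.1 j.2.
pose f (u : T) : cspace R KE := enc (h (a u) (dec u.1.1)).
have fE u q : dec (f u) q = h (a u) (dec u.1.1) q by rewrite encK.
exists f; split.
- apply: measurable_enc => q; apply: cmeasD.
    apply: cmeas_sum => j; apply: cmeasM; last exact: cmeas_cst.
    rewrite /a /G; under [X in cmeas X]eq_fun do rewrite mxE.
    case: (fintype.split j.2) => l.
      apply: (cmeas_comp (cmeas_dmx j.1 l)).
      exact: measurableT_comp measurable_snd measurable_fst.
    exact: (cmeas_comp (cmeas_dmx j.1 l) measurable_snd).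
  apply: cmeas_sum => j; apply: cmeasM; last exact: cmeas_cst.
  apply: (cmeas_comp (cmeas_dec j)).
  exact: measurableT_comp measurable_fst measurable_fst.
- move=> u w; apply: dec_inj => q; rewrite dec_add !fE /h addrACA.
  congr (_ + _); rewrite -big_split /=; apply: eq_bigr => j _;
    rewrite -mulrDl; congr (_ * _); last by rewrite dec_add.
  by rewrite /a /G /= !dmx_add -add_row_mx mxE.
- move=> t; have [a' [e he]] := hS (dec t).
  pose F : cspace R ('I_(k + 1) * 'I_k)%type := enc (fun j => a' (j.1, lshift 1 j.2)).
  pose g : cspace R ('I_(k + 1) * 'I_1)%type := enc (fun j => a' (j.1, rshift k j.2)).
  exists ((enc e, F), g); apply: dec_inj => q; rewrite fE -he /h.
  congr (_ + _); apply: eq_bigr => j _; rewrite /= ?encK//.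
  congr (_ * _); rewrite /a /G /=; case: j => j1 j2 /=.
  rewrite mxE; case: splitP => l lE; rewrite mxE encK /=;
    by congr (a' (_, _)); apply: val_inj.
- move=> u; rewrite enrm_cspace; under eq_bigr do rewrite fE.
  rewrite hN /= enrm_cspace !enrm_mx sum_pair addrC -addrA; congr (_ + _).
  rewrite -big_split /=; apply: eq_bigr => i _; rewrite big_split_ord /=.
  by congr (_ + _); apply: eq_bigr => j _; rewrite /a /G /= ?row_mxEl ?row_mxEr.
- move=> u; apply/matrixP => i j; rewrite [RHS]mxE -[row_mx _ _ i j]/(a u (i, j)).
  rewrite -(hL (a u) (dec u.1.1) (i, j)) compressE mulr_sumr [RHS]sum_pair [RHS]sum_pair.
  apply: eq_bigr => l _; apply: eq_bigr => c _; apply: eq_bigr => d _.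
  rewrite fE /L /= !mulrA -rmorphM /= divff ?rmorph1 ?mul1r//.
  by rewrite gt_eqF// sqrtr_gt0 zscale_gt0.
Qed.

End Perturbation.

(** * The sensitivity as a function of the perturbation vector *)

Section Sensitivity.
Context {R : realType} (n m k : nat).
Local Notation C := R[i].
Variables (A : 'I_m.+1 -> 'M[C]_n) (X Y : 'M[C]_(n, k)) (x y : 'cV[C]_n) (z0 : C).
Let KE : finType := ('I_m.+1 * 'I_n * 'I_n)%type.
Let beta : C := sesq y (mpderiv A z0) x.
Let gamma := gammaP A z0 x y.

Lemma normc_ge0 (z : C) : 0 <= normc z.
Proof. by rewrite normcE2 sqrtr_ge0. Qed.

Lemma normcMc (z w : C) : normc (z * w) = normc z * normc w.
Proof. exact: ComplexField.Normc.normcM. Qed.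

Lemma normcVc (z : C) : normc z^-1 = (normc z)^-1.
Proof. exact: ComplexField.Normc.normcV. Qed.

Lemma normc_realX (a : R) j : 0 <= a -> normc (a%:C%C ^+ j) = a ^+ j.
Proof.
move=> a0; rewrite normcE2 cn2X cn2_real -exprM mulnC exprM sqrtr_sqr.
by rewrite ger0_norm// exprn_ge0.
Qed.

Definition tsens (t : cspace R KE) : R := sensitivity A z0 X Y x y (emat t).

Let cmp (t : cspace R KE) : 'M[C]_k := ctmx Y *m mpeval (emat t) z0 *m X.

Lemma compress_corner t : cmp t = usubmx (lsubmx (compress X Y x y z0 t)).
Proof.
rewrite /compress mul_mx_row row_mxKl /cmp /ctmx map_row_mx tr_row_mx.
by rewrite !mul_col_mx col_mxKu.
Qed.

Lemma tsensE t : tsens t = (Num.sqrt (enrm (ceuclid KE) t))^-1 *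
  (normc (\det (compress X Y x y z0 t)) * (normc beta * normc (\det (cmp t)))^-1).
Proof. by rewrite /tsens /sensitivity mpnorm_emat normcMc normcVc normcMc. Qed.

Lemma tsens_ge0 t : 0 <= tsens t.
Proof.
by rewrite tsensE !mulr_ge0 ?invr_ge0 ?mulr_ge0 ?normc_ge0 ?sqrtr_ge0.
Qed.

Lemma emat_scal a (t : cspace R KE) : emat (escal (ceuclid KE) a t) = fun i => a%:C%C *: emat t i.
Proof. by apply/funext => i; apply/matrixP => b c; rewrite !mxE dec_scal. Qed.

Lemma mpeval_scal a (t : cspace R KE) :
  mpeval (emat (escal (ceuclid KE) a t)) z0 = a%:C%C *: mpeval (emat t) z0.
Proof.
rewrite emat_scal /mpeval scaler_sumr; apply: eq_bigr => i _.
by rewrite scalerA mulrC -scalerA.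
Qed.

(** The numerator has degree k + 1, and so has the denominator: one from the norm and k from the
    corner. This is what lets the ball replace the sphere. *)
Lemma tsens_scal a t : 0 < a -> tsens (escal (ceuclid KE) a t) = tsens t.
Proof.
move=> a0; have an0 : a != 0 by rewrite gt_eqF.
have rE : Num.sqrt (enrm (ceuclid KE) (escal (ceuclid KE) a t)) =
          a * Num.sqrt (enrm (ceuclid KE) t).
  by rewrite (enrm_scal (ceuclid KE)) (sqrtrM _ (sqr_ge0 a)) sqrtr_sqr gtr0_norm.
rewrite (tsensE t) (tsensE (escal _ _ _)) rE.
rewrite /cmp /compress mpeval_scal -!scalemxAr -!scalemxAl !detZ !normcMc.
rewrite !normc_realX ?(ltW a0)// exprD expr1; set u := normc (\det _); set v := normc (\det _).
have ak : a ^+ k != 0 by rewrite expf_neq0.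
rewrite !invfM; move: (Num.sqrt _) => s; set ai := a^-1; set aki := (a ^+ k)^-1.
transitivity ((a * ai) * (a ^+ k * aki) * (s^-1 * (u * ((normc beta)^-1 * v^-1)))).
  by ring.
by rewrite /ai /aki !divff// !mul1r.
Qed.

Lemma cmeas_emat i a b : cmeas (fun t : cspace R KE => emat t i a b).
Proof. by under [X in cmeas X]eq_fun do rewrite mxE; exact: cmeas_dec. Qed.

Lemma cmeas_mpeval a b : cmeas (fun t : cspace R KE => mpeval (emat t) z0 a b).
Proof.
rewrite /mpeval; under [X in cmeas X]eq_fun do rewrite summxE.
apply: cmeas_sum => i; under [X in cmeas X]eq_fun do rewrite mxE.
by apply: cmeasM; [exact: cmeas_cst|exact: cmeas_emat].
Qed.

Lemma measurable_sqrt d (T : measurableType d) (f : T -> R) :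
  measurable_fun setT f -> measurable_fun setT (fun u => Num.sqrt (f u)).
Proof.
move=> mf.
have ms : measurable_fun setT (Num.sqrt : R -> R).
  by apply: continuous_measurable_fun; exact: sqrt_continuous.
exact: (measurableT_comp ms mf).
Qed.

Lemma measurable_normc d (T : measurableType d) (f : T -> C) :
  cmeas f -> measurable_fun setT (fun u => normc (f u)).
Proof.
move=> mf; under eq_fun do rewrite normcE2.
exact/measurable_sqrt/measurable_cn2.
Qed.

Lemma measurable_tsens : measurable_fun setT tsens.
Proof.
have mc p q (U : 'M[C]_(p, n)) (V : 'M[C]_(n, q)) i j :
    cmeas (fun t : cspace R KE => (U *m mpeval (emat t) z0 *m V) i j).
  apply: cmeas_mulmx => c d; last exact: cmeas_cst.
  by apply: cmeas_mulmx => *; [exact: cmeas_cst|exact: cmeas_mpeval].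
rewrite (funext tsensE); apply: measurable_funM.
  apply: measurable_inv_ge0 => [t|]; first exact: sqrtr_ge0.
  exact/measurable_sqrt/enrm_meas.
apply: measurable_funM.
  by apply: measurable_normc; apply: cmeas_det => i j; exact: mc.
apply: measurable_inv_ge0 => [t|]; first by rewrite mulr_ge0 ?normc_ge0.
apply: measurable_funM; first exact: measurable_cst.
by apply: measurable_normc; apply: cmeas_det => i j; exact: mc.
Qed.

(** The square root of [zscale] comes out k + 1 times above and k times below, leaving sigma_E =
    |det [F g]| / (gamma |E| |det [F e_last]|). *)
Lemma tsens_ge t (t0 : R) (F : 'M[C]_(k + 1, k)) (g : 'cV[C]_(k + 1)) :
  0 < t0 -> gamma != 0 ->
  compress X Y x y z0 t = (Num.sqrt (zscale m z0))%:C%C *: row_mx F g ->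
  0 < enrm (ceuclid KE) t -> bdet F elast != 0 ->
  (gamma * t0) ^+ 2 * enrm (ceuclid KE) t * cn2 (bdet F elast) <= cn2 (bdet F g) ->
  t0 <= tsens t.
Proof.
move=> t0_gt0 g0 cE e0 b0 h.
have s0 : 0 < zscale m z0 := zscale_gt0 m z0.
have sq0 : 0 < Num.sqrt (zscale m z0) by rewrite sqrtr_gt0.
have b1 : normc beta != 0.
  by apply: contra g0 => /eqP bE; rewrite /gamma /gammaP -/beta bE mul0r.
have sE : gamma = normc beta / Num.sqrt (zscale m z0) by [].
have n0 (z : C) : z != 0 -> 0 < normc z.
  by move=> hz; rewrite normcE2 sqrtr_gt0 lt_neqAle cn2_ge0 eq_sym cn2_eq0 hz.
have bl := n0 _ b0.
have b2 : 0 < normc beta by rewrite lt_neqAle eq_sym b1 normc_ge0.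
have cornerE : cmp t = (Num.sqrt (zscale m z0))%:C%C *: usubmx F.
  by rewrite compress_corner cE !linearZ /= row_mxKl.
rewrite tsensE cE cornerE !detZ -/(bdet F g) -bdet_last !normcMc.
rewrite !normc_realX ?(ltW sq0)//.
have h' : gamma * t0 * Num.sqrt (enrm (ceuclid KE) t) * normc (bdet F elast)
    <= normc (bdet F g).
  have g1 : 0 <= gamma by rewrite sE divr_ge0 ?normc_ge0// ltW.
  move: (gamma) g1 h => G G0 h.
  rewrite -ler_sqr ?nnegrE ?mulr_ge0 ?normc_ge0 ?sqrtr_ge0 ?(ltW t0_gt0)//.
  by rewrite exprMn in h; rewrite !exprMn !normc_sq sqr_sqrtr ?(ltW e0).
have r0 : 0 < Num.sqrt (enrm (ceuclid KE) t) by rewrite sqrtr_gt0.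
move: h' bl r0; rewrite sE exprD expr1.
move: (Num.sqrt (enrm _ _)) (normc (bdet F elast)) (normc (bdet F g)) => r l d h' l0 r0.
have sk : 0 < Num.sqrt (zscale m z0) ^+ k by rewrite exprn_gt0.
move: (Num.sqrt (zscale m z0)) (Num.sqrt (zscale m z0) ^+ k) sq0 sk h' => s sj s1 sk h'.
have -> : r^-1 * (sj * s * d * (normc beta * (sj * l))^-1) = s * d / (r * normc beta * l).
  by field; rewrite !gt_eqF.
rewrite ler_pdivlMr ?mulr_gt0//.
have -> : t0 * (r * normc beta * l) = s * (normc beta / s * t0 * r * l).
  by field; rewrite gt_eqF.
by rewrite ler_pM2l.
Qed.

End Sensitivity.

(** * The weak condition number *)

Section Sphere.
Context {R : realType} (D : nat).
Let X := @tuple_euclid R D.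

Lemma tnormE (t : D.-tuple R) : tnorm t = Num.sqrt (enrm X t).
Proof. by rewrite /tnorm enrm_tuple. Qed.

Lemma tscaleE a (t : D.-tuple R) : tscale a t = escal X a t.
Proof. by apply: eq_from_tnth => i; rewrite tnth_mktuple tnth_escal. Qed.

Lemma sqrt_le1 (a : R) : 0 <= a -> (Num.sqrt a <= 1) = (a <= 1).
Proof. by move=> a0; rewrite -[in LHS]sqrtr1 ler_sqrt. Qed.

(** By invariance under dilations the cone over the set is its trace on the punctured ball. It is
    disjoint from the set of the hypothesis, and both fit in the unit ball. *)
Lemma sphere_measure_lt (h : D.-tuple R -> R) (t0 b : R) :
  measurable_fun setT h ->
  (forall a t, 0 < a -> h (escal X a t) = h t) ->
  ((b * rvol X)%:E <= evol X [set t | (0 < enrm X t <= 1)%R /\ (t0 <= h t)%R])%E ->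
  sphere_measure [set t | h t < t0] <= 1 - b.
Proof.
move=> mh hs hb; have V0 : 0 < rvol X := rvol_gt0 X.
set S := [set t | _ /\ _] in hb.
set A := [set t | _].
have mO : measurable [set t | 0 < enrm X t].
  by apply: measurable_lt_fun; [exact: measurable_cst|exact: enrm_meas].
have mA : measurable A by apply: measurable_lt_fun => //; exact: measurable_cst.
have mB : measurable (ball1 X) := measurable_ball1 X.
have coneE : cone A = [set t | 0 < enrm X t] `&` ball1 X `&` A.
  apply/seteqP; split=> t; rewrite /cone /= tnormE sqrtr_gt0 sqrt_le1 ?enrm_ge0//.
    move=> [/andP[e0 e1] At]; split; first by split.
    by move: At; rewrite /A /= tscaleE hs// invr_gt0 sqrtr_gt0.
  move=> [[e0 e1] At]; split; first by rewrite e0 e1.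
  by rewrite /A /= tscaleE hs// invr_gt0 sqrtr_gt0.
have mC : measurable (cone A).
  by rewrite coneE; apply: measurableI => //; exact: measurableI.
have mS : measurable S.
  rewrite (_ : S = [set t | 0 < enrm X t] `&` ball1 X `&` [set t | t0 <= h t]).
    apply: measurableI; first exact: measurableI.
    by apply: measurable_le_fun => //; exact: measurable_cst.
  by apply/seteqP; split=> t; rewrite /S /ball1 /=; [case=> /andP[? ?] ?|case=> -[-> ->] ?].
rewrite /sphere_measure.
have -> : [set t : D.-tuple R | tnorm t <= 1] = ball1 X.
  by apply/seteqP; split=> t; rewrite /ball1 /= tnormE sqrt_le1 ?enrm_ge0.
rewrite -!evol_tuple// -/X -/(rvol X) ler_pdivrMr//.
have add : (evol X (cone A) + evol X S <= (rvol X)%:E)%E.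
  rewrite -measureU//; last first.
    rewrite coneE; apply/seteqP; split=> t //=.
    by move=> [[_ h1] [_ h2]]; move: h1; rewrite /A /= ltNge h2.
  rewrite -rvolE; apply: le_measure; rewrite ?inE//; first exact: measurableU.
  by move=> t [|]; [rewrite coneE => -[[]]|case=> /andP[]].
have fC : evol X (cone A) \is a fin_num.
  rewrite ge0_fin_numE ?measure_ge0//; apply: (@le_lt_trans _ _ (rvol X)%:E).
    by apply: le_trans add; rewrite leeDl.
  by rewrite ltry.
have : (evol X (cone A) + (b * rvol X)%:E <= (rvol X)%:E)%E.
  by apply: le_trans add; rewrite leeD2l.
by rewrite -(fineK fC) -EFinD lee_fin => ?; lra.
Qed.

End Sphere.

(** * From volumes to the weak condition number *)

Section WeakCond.
Context {R : realType} (n m k : nat).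
Local Notation C := R[i].
Variables (A : 'I_m.+1 -> 'M[C]_n) (X Y : 'M[C]_(n, k)) (x y : 'cV[C]_n) (z0 : C).
Variables (d : measure_display) (T : measurableType d) (Pr : probability T R).
Variable E : T -> 'I_m.+1 -> 'M[C]_n.
Hypothesis k0 : (0 < k)%N.
Hypothesis oX : orthonormal_cols (row_mx X x).
Hypothesis oY : orthonormal_cols (row_mx Y y).
Hypothesis uE : uniform_perturbation Pr E.
Let gamma := gammaP A z0 x y.
Let sigma w := sensitivity A z0 X Y x y (E w).
Let N : R := (n ^ 2 * (m + 1))%:R.
Let K : R := k%:R.
Let B : R := (N - 1) * K / ((N + K - 2) * (N + K - 1)).
Let KE : finType := ('I_m.+1 * 'I_n * 'I_n)%type.
Let h : cspace R KE -> R := tsens A X Y x y z0.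

Let sigmaE w : sigma w = h (realvec (E w)).
Proof. by rewrite /h /tsens emat_realvec. Qed.

Let Z (w : T) : cspace R KE := realvec (E w).
Let mZ : measurable_fun setT Z. Proof. by case: uE. Qed.

Lemma card_perturbation : exists p,
  (p + (k + 1) * (k + 1) = m.+1 * n * n)%N.
Proof. by have [p [e _]] := compress_isometry m 0 oX oY; exists p. Qed.

(** The (k + 1)^2 orthonormal coordinates of the compression fit in a space of complex dimension
    N. *)
Lemma N_bounds : (K + 1) ^+ 2 <= N /\ 1 <= K.
Proof.
have [p e] := card_perturbation; split; last by rewrite ler1n.
rewrite /N /K natr1 -natrX ler_nat.
have -> : (n ^ 2 * (m + 1) = p + (k + 1) * (k + 1))%N by rewrite e addn1 -mulnn; lia.
by rewrite -addn1 -mulnn leq_addl.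
Qed.

(** The strict inequality is what keeps t0 out of the set whose infimum is [weak_cond]. *)
Lemma sensitivity_lt_prob (t0 delta : R) : gamma != 0 -> 0 < t0 -> 0 < delta ->
  delta <= B -> (gamma * t0) ^+ 2 * delta < B ->
  (Pr [set w | (sigma w < t0)%R] < (1 - delta)%:E)%E.
Proof.
move=> g0 t00 d0 dB sB.
have [p [e]] := compress_isometry m z0 oX oY.
set V := prod_euclid _ _ => -[f [mf fD fS fN fC]].
have NE : N = (p + (k + 1) * k + k)%:R + 1.
  rewrite /N natr1; congr (_%:R); move: e; rewrite -mulnn; lia.
set M : R := (p + (k + 1) * k + k)%:R in NE.
have BE : B = M * K / ((M + K - 1) * (M + K)).
  by rewrite /B NE; congr (_ * _ / (_ * _)); ring.
have s0 : 0 < (gamma * t0) ^+ 2.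
  by rewrite lt_neqAle sqr_ge0 andbT eq_sym expf_neq0// mulf_neq0// gt_eqF.
rewrite BE in dB sB.
have [b db hb] := evol_bordered_gt k0 s0 d0 dB sB.
set S := [set t : cspace R KE | 0 < enrm (ceuclid KE) t <= 1 /\ t0 <= h t].
have mh : measurable_fun setT h := measurable_tsens A X Y x y z0.
have mS : measurable S.
  rewrite (_ : S = [set t | 0 < enrm (ceuclid KE) t] `&` ball1 (ceuclid KE) `&`
                   [set t | t0 <= h t]).
    apply: measurableI; last by apply: measurable_le_fun => //; exact: measurable_cst.
    apply: measurableI; last exact: measurable_ball1.
    by apply: measurable_lt_fun; [exact: measurable_cst|exact: enrm_meas].
  by apply/seteqP; split=> t; rewrite /S /ball1 /=; [case=> /andP[? ?] ?|case=> -[-> ->] ?].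
have hS : ((b * rvol (ceuclid KE))%:E <= evol (ceuclid KE) S)%E.
  rewrite (evol_isometryE mf fD fS fN mS).
  have r1 := rvol_gt0 V; have r2 := rvol_gt0 (@ceuclid R KE).
  have -> : ((b * rvol (ceuclid KE))%:E =
      (rvol (ceuclid KE) / rvol V)%:E * (b * rvol V)%:E)%E.
    by rewrite -EFinM; congr EFin; field; rewrite gt_eqF.
  apply: lee_wpmul2l; first by rewrite lee_fin divr_ge0 ?(ltW r1) ?(ltW r2).
  apply: (le_trans hb); apply: le_measure; rewrite ?inE.
  - exact: measurable_bordered.
  - exact: measurable_preim.
  - move=> u [/andP[u0 u1] bl hu]; split; first by rewrite fN u0 u1.
    apply: (tsens_ge t00 g0 (fC u)) => //; first by rewrite fN.
    by rewrite fN.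
have mA : measurable [set t : cspace R KE | h t < t0].
  by apply: measurable_lt_fun => //; exact: measurable_cst.
have -> : [set w | sigma w < t0] = Z @^-1` [set t | h t < t0].
  by apply/seteqP; split=> w /=; rewrite sigmaE.
case: uE => _ /(_ _ mA) ->; rewrite lte_fin.
apply: le_lt_trans (sphere_measure_lt mh _ hS) _; last by lra.
by move=> a t a0; exact: tsens_scal.
Qed.

Lemma bound_lt1 : B < 1.
Proof.
have [N1 K1] := N_bounds.
have h0 : 0 < (N + K - 2) * (N + K - 1) by apply: mulr_gt0; nra.
rewrite ltr_pdivrMr// mul1r; nra.
Qed.

(** For t <= 0 the event is empty, whereas 1 - delta is positive since delta <= B < 1. *)
Lemma weak_cond_set_gt0 (delta t : R) : delta <= B ->
  ((1 - delta)%:E <= Pr [set w | (sigma w < t)%R])%E -> 0 < t.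
Proof.
move=> dB; apply: contraTlt => t_le0; rewrite -ltNge (_ : [set w | _] = set0).
  by rewrite measure0 lte_fin subr_gt0 (le_lt_trans dB bound_lt1).
apply/seteqP; split=> // w /= sw; have := tsens_ge0 A X Y x y z0 (realvec (E w)).
by rewrite -/h -sigmaE => s0; have := lt_le_trans sw t_le0; rewrite ltNge s0.
Qed.

(** Ensures that the infimum is not the default value of the empty set. The sensitivity is a real
    number at every point, so the events sigma < j exhaust the space and their probabilities tend to
    1. *)
Lemma weak_cond_set_nonempty (delta : R) : 0 < delta ->
  exists t, ((1 - delta)%:E <= Pr [set w | (sigma w < t)%R])%E.
Proof.
move=> d0; pose F (j : nat) := [set w | sigma w < j%:R].
have mF j : measurable (F j).
  rewrite (_ : F j = Z @^-1` [set t | h t < j%:R]).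
    apply: measurable_preim; first exact: mZ.
    by apply: measurable_lt_fun; [exact: measurable_tsens|exact: measurable_cst].
  by apply/seteqP; split=> w; rewrite /F /= sigmaE.
have FT : \bigcup_j F j = setT.
  apply/seteqP; split=> // w _; exists (Num.truncn (sigma w)).+1 => //.
  exact: truncnS_gt.
have ndF : nondecreasing_seq F.
  move=> i j ij; apply/subsetPset => w; rewrite /F /= => /lt_le_trans; apply.
  by rewrite ler_nat.
have cv : Pr \o F @ \oo --> 1%E.
  rewrite -(probability_setT Pr) -FT; apply: nondecreasing_cvg_mu => //.
  exact: bigcupT_measurable.
apply: contrapT => /forallNP no.
have : (1 <= (1 - delta)%:E)%E.
  apply: (cvge_le _ cv).
  by apply: nearW => j; apply/ltW; rewrite ltNge; apply/negP; exact: no.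
by rewrite lee_fin; lra.
Qed.

Lemma weak_cond_ge (delta : R) : 0 < delta -> delta <= B ->
  Num.sqrt (B / delta) * (1 / gamma) <= weak_cond Pr sigma delta.
Proof.
move=> d0 dB.
have ne := weak_cond_set_nonempty d0.
have pos t : ((1 - delta)%:E <= Pr [set w | (sigma w < t)%R])%E -> 0 < t.
  exact: weak_cond_set_gt0.
apply: lb_le_inf => // t /= ht; have t0 := pos _ ht.
(* For gamma = 0 the quotient 1 / gamma is 0 by convention, and so is the bound. *)
have [g0|g0] := eqVneq gamma 0; first by rewrite g0 invr0 mulr0 mulr0 ltW.
have gp : 0 < gamma.
  by rewrite lt_neqAle eq_sym g0 divr_ge0 ?normc_ge0 ?sqrtr_ge0.
rewrite leNgt; apply/negP => lt; move: ht; rewrite leNgt => /negP; apply.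
apply: sensitivity_lt_prob => //.
have B0 : 0 <= B by rewrite (le_trans (ltW d0)).
rewrite mul1r ltr_pdivlMr// in lt.
have : (gamma * t) ^+ 2 < B / delta.
  have tg0 : 0 <= t * gamma by rewrite mulr_ge0 ?(ltW t0) ?(ltW gp).
  rewrite mulrC -[ltRHS]sqr_sqrtr ?(divr_ge0 B0 (ltW d0))//.
  by rewrite ltr_sqr ?nnegrE ?sqrtr_ge0.
by rewrite ltr_pdivlMr.
Qed.

(** Once denominators are cleared the difference is (K - 1)(N (N - 3) + 2 - K): zero for K = 1, and
    nonnegative for K >= 2 because N >= (K + 1)^2 >= 9. *)
Lemma inv_card_le_bound : 1 / N <= B.
Proof.
have [N1 K1] := N_bounds.
have h1 : 0 < (N + K - 2) * (N + K - 1) by apply: mulr_gt0; nra.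
have N0 : 0 < N by nra.
rewrite ler_pdivlMr// mul1r ler_pdivrMl// mulrA.
have [->|K2] : K = 1 \/ 2 <= K.
  rewrite /K; case: (ltnP 1 k) => [k2|k2]; first by right; rewrite ler_nat.
  by left; rewrite (_ : k = 1%N)//; lia.
  by nra.
have N9 : 9 <= N by nra.
have KN : K <= N by nra.
rewrite -subr_ge0 (_ : _ - _ = (K - 1) * (N * (N - 3) + 2 - K)); last by ring.
by apply: mulr_ge0; nra.
Qed.

End WeakCond.

Theorem theorem3p1 (R : realType) (n m r : nat)
    (A : 'I_m.+1 -> 'M[R[i]]_n) (lambda0 : R[i])
    (BX BY : 'M[{poly R[i]}]_(n, n - r))
    (X Y : 'M[R[i]]_(n, n - r)) (x y : 'cV[R[i]]_n)
    (d : measure_display) (T : measurableType d) (Pr : probability T R)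
    (E : T -> 'I_m.+1 -> 'M[R[i]]_n) (delta : R) :
  normal_rank A r -> (r < n)%N ->
  simple_eigenvalue_mp A lambda0 ->
  minimal_basis (singular_space A) BX ->
  minimal_basis (left_singular_space A) BY ->
  orthonormal_cols (row_mx X x) ->
  orthonormal_cols (row_mx Y y) ->
  col_basis (row_mx X x) (nullspace (mpeval A lambda0)) ->
  col_basis (row_mx Y y) (nullspace (ctmx (mpeval A lambda0))) ->
  col_basis X (colspace (eval_mx BX lambda0)) ->
  col_basis Y (colspace (eval_mx BY (conjc lambda0))) ->
  uniform_perturbation Pr E ->
  let gamma := gammaP A lambda0 x y in
  let kappa := weak_cond Pr
    (fun w => sensitivity A lambda0 X Y x y (E w)) delta in
  let N : R := (n ^ 2 * (m + 1))%:R in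
  let k : R := (n - r)%:R in
  0 < delta ->
  delta <= ((N - 1) * k) / ((N + k - 2) * (N + k - 1)) ->
  Num.sqrt (((N - 1) * k) / ((N + k - 2) * (N + k - 1) * delta)) * (1 / gamma)
    <= kappa /\
  1 / Num.sqrt (N * delta) * (1 / gamma)
    <= Num.sqrt (((N - 1) * k) / ((N + k - 2) * (N + k - 1) * delta))
       * (1 / gamma).
Proof.
move=> _ rn _ _ _ oX oY _ _ _ _ uE gamma kappa N k d0 dB.
have k0 : (0 < n - r)%N by rewrite subn_gt0.
have -> : (N - 1) * k / ((N + k - 2) * (N + k - 1) * delta) =
          (N - 1) * k / ((N + k - 2) * (N + k - 1)) / delta.
  by rewrite invfM mulrA.
split; first exact: (weak_cond_ge A lambda0 k0 oX oY uE d0 dB).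
have [Nk K1] := N_bounds m k0 oX oY.
have hN := inv_card_le_bound m k0 oX oY.
apply: ler_wpM2r.
  by rewrite mul1r invr_ge0 divr_ge0 ?normc_ge0 ?sqrtr_ge0.
rewrite mul1r -sqrtrV ?mulr_ge0 ?ler0n ?(ltW d0)//.
rewrite ler_wsqrtr// invfM ler_wpM2r ?invr_ge0 ?(ltW d0)//.
by move: hN; rewrite mul1r.
Qed.
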